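(* Let $f$ be a diffeomorphism of a compact manifold $\mathcal{M}$, let $\mathcal{E}$ be a finite dimensional vector bundle over $\mathcal{M}$, and let $F:\mathcal{E}\to\mathcal{E}$ be a continuous linear cocycle over $f$. If $F$ is uniformly quasiconformal, then it preserves a bounded measurable conformal structure $\tau$ on $\mathcal{E}$.
   Context: $\mathcal{E}$ is equipped with a continuous background Riemannian metric (inner products on the fibers depending continuously on the base point). A continuous linear cocycle over $f$ is a homeomorphism $F:\mathcal{E}\to\mathcal{E}$ covering $f$ whose restrictions $F_x:\mathcal{E}_x\to\mathcal{E}_{fx}$ are linear isomorphisms depending continuously on $x$; $F^n_x:\mathcal{E}_x\to\mathcal{E}_{f^nx}$, $n\in\mathbb{Z}$, is the $n$-th iterate. $F$ is uniformly quasiconformal if $K_F(x,n)=\|F^n_x\|\cdot\|(F^n_x)^{-1}\|$ is uniformly bounded for all $x\in\mathcal{M}$, $n\in\mathbb{Z}$. A conformal structure on $\mathcal{E}_x$ is a class of proportional inner products on $\mathcal{E}_x$; using the background metric it is identified with a symmetric positive definite operator of determinant $1$ on $\mathcal{E}_x$. The space $\mathcal{C}(x)$ of these is given the following distance, with $d=\dim\mathcal{E}_x$: identify $\mathcal{C}(x)$ with the space $\mathcal{C}^d$ of symmetric positive definite $d\times d$ matrices of determinant $1$, on which $GL(d,\mathbb{R})$ acts by $X[C]=(\det X^TX)^{-1/d}X^TCX$; then $\mathrm{dist}(\mathrm{Id},C)=\frac{\sqrt d}{2}\left(\sum_{i=1}^d(\log\lambda_i)^2\right)^{1/2}$, where $\lambda_i$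 are the eigenvalues of $C$, and $\mathrm{dist}(C_1,C_2)=\mathrm{dist}(\mathrm{Id},X[C_2])$ where $X[C_1]=\mathrm{Id}$. A (measurable, continuous) conformal structure $\tau$ on $\mathcal{E}$ is a choice of $\tau(x)\in\mathcal{C}(x)$ depending (measurably, continuously) on $x\in\mathcal{M}$. A measurable $\tau$ is bounded if $\mathrm{dist}(\tau(x),\tau_0(x))$ is uniformly bounded on $\mathcal{M}$ for a continuous conformal structure $\tau_0$ on $\mathcal{E}$. $F$ preserves $\tau$ if the pull-back of $\tau(fx)$ by $F_x$ equals $\tau(x)$ for all $x$. *)

(* Defs.v *)
From HB Require Import structures.
From mathcomp Require Import all_boot all_order all_algebra.
From mathcomp Require Import sesquilinear.
From mathcomp Require Import all_classical all_reals all_analysis.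

Set Implicit Arguments.
Unset Strict Implicit.
Unset Printing Implicit Defensive.

Import Order.TTheory GRing.Theory Num.Theory.
Import numFieldNormedType.Exports.

Local Open Scope classical_set_scope.
Local Open Scope ring_scope.

(** * Smooth manifolds and diffeomorphisms *)

(* [U] is meant to be open. *)
Fixpoint is_Ck (R : realType) (n m k : nat) (U : set 'rV[R]_n)
    (h : 'rV[R]_n -> 'rV[R]_m) : Prop :=
  match k with
  | 0%N => {within U, continuous h}
  | k'.+1 => (forall x, U x -> differentiable h x) /\
             (forall v, is_Ck k' U ('D_v h))
  end.

Record chart (R : realType) (n : nat) (M : topologicalType) := Chart {
  chart_dom : set M;
  chart_map :> M -> 'rV[R]_n;
  chart_inv : 'rV[R]_n -> M;
  chart_dom_open : open chart_dom;
  chart_im_open : open (chart_map @` chart_dom);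
  chartK : forall x, chart_dom x -> chart_inv (chart_map x) = x;
  chart_continuous : {within chart_dom, continuous chart_map};
  chart_inv_continuous :
    {within chart_map @` chart_dom, continuous chart_inv} }.

Record manifold (R : realType) (n : nat) := Manifold {
  mfd_top :> topologicalType;
  mfd_hausdorff : hausdorff_space mfd_top;
  mfd_second_countable : @second_countable mfd_top;
  mfd_atlas : set (chart R n mfd_top);
  mfd_cover : forall x, exists2 a, mfd_atlas a & chart_dom a x;
  mfd_compat : forall a b, mfd_atlas a -> mfd_atlas b ->
    forall k, is_Ck k (a @` (chart_dom a `&` chart_dom b))
                      (b \o chart_inv a) }.

Definition is_C1_map (R : realType) (n : nat) (M : manifold R n)
    (h : M -> M) : Prop :=
  continuous h /\
  forall a b, mfd_atlas a -> mfd_atlas b ->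
    is_Ck 1 (a @` (chart_dom a `&` h @^-1` chart_dom b))
            (b \o h \o chart_inv a).

(* Only one derivative is required, so that diffeomorphisms of any class
   C^r, 1 <= r <= oo, are covered. *)
Record diffeo (R : realType) (n : nat) (M : manifold R n) := Diffeo {
  diffeo_map :> M -> M;
  diffeo_inv : M -> M;
  diffeoK : cancel diffeo_map diffeo_inv;
  diffeo_invK : cancel diffeo_inv diffeo_map;
  diffeo_C1 : is_C1_map diffeo_map;
  diffeo_inv_C1 : is_C1_map diffeo_inv }.

(** * Vector bundles *)

(* The fibre over [x] is kept as an abstract vector space [fiber x], identified
   by [fiber_incl x] with the subset [bundle_proj^-1 (x)] of the total space. *)
Record bundle_data (R : realType) (M : topologicalType) := BundleData {
  total_space : topologicalType;
  bundle_proj : total_space -> M;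
  fiber : M -> vectType R;
  fiber_incl : forall x, fiber x -> total_space;
  proj_continuous : continuous bundle_proj;
  incl_bij : forall x,
    set_bij setT (bundle_proj @^-1` [set x]) (@fiber_incl x) }.

Arguments total_space {R M}.
Arguments bundle_proj {R M}.
Arguments fiber {R M}.
Arguments fiber_incl {R M} b x.

(* A local trivialization [triv_dom * R^r -> bundle_proj^-1 (triv_dom)] is given
   by the images [triv_frame x] of the canonical basis of [R^r]; [triv_coord] is
   the second component of the inverse homeomorphism. *)
Record trivialization (R : realType) (M : topologicalType)
    (E : bundle_data R M) := Trivialization {
  triv_dom : set M;
  triv_rank : nat;
  triv_frame : forall x, triv_rank.-tuple (fiber E x);
  triv_coord : total_space E -> 'rV[R]_triv_rank;
  triv_dom_open : open triv_dom;
  triv_basis : forall x, triv_dom x -> basis_of fullv (triv_frame x);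
  triv_coordE : forall x (v : fiber E x), triv_dom x ->
    triv_coord (fiber_incl E x v) = \row_i coord (triv_frame x) i v;
  triv_continuous : {within triv_dom `*` [set: 'rV[R]_triv_rank],
    continuous (fun p : M * 'rV[R]_triv_rank =>
      fiber_incl E p.1 (\sum_i p.2 0 i *: tnth (triv_frame p.1) i))};
  triv_coord_continuous :
    {within bundle_proj E @^-1` triv_dom, continuous triv_coord} }.

(* The rank is only required to be locally constant. *)
Record vector_bundle (R : realType) (M : topologicalType) := VectorBundle {
  bundle_of :> bundle_data R M;
  bundle_trivial : forall x,
    exists t : trivialization bundle_of, triv_dom t x }.

(* [{dot V for idfun}] is the type of inner products on the real space [V]. *)
Record bundle_metric (R : realType) (M : topologicalType)
    (E : vector_bundle R M) := BundleMetric {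
  metric :> forall x, {dot (fiber E x) for idfun};
  metric_continuous : forall (t : trivialization E) (i j : 'I_(triv_rank t)),
    {within triv_dom t, continuous (fun x =>
      metric x (tnth (triv_frame t x) i) (tnth (triv_frame t x) j))} }.

(** * Linear cocycles and quasiconformality *)

(* Continuous dependence of the fibre maps on the base point is, in local
   trivializations, the continuity of [cocycle_map]. *)
Record linear_cocycle (R : realType) (M : topologicalType)
    (E : vector_bundle R M) (f : M -> M) := LinearCocycle {
  cocycle_map : total_space E -> total_space E;
  cocycle_inv : total_space E -> total_space E;
  cocycle_mapK : cancel cocycle_map cocycle_inv;
  cocycle_invK : cancel cocycle_inv cocycle_map;
  cocycle_continuous : continuous cocycle_map;
  cocycle_inv_continuous : continuous cocycle_inv;
  cocycle_fiber :> forall x, 'Hom(fiber E x, fiber E (f x));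
  cocycle_fiber_bij : forall x, bijective (cocycle_fiber x);
  cocycle_mapE : forall x v,
    cocycle_map (fiber_incl E x v) = fiber_incl E (f x) (cocycle_fiber x v) }.

Definition iterz (T : Type) (h hinv : T -> T) (k : int) : T -> T :=
  match k with
  | Posz m => iter m h
  | Negz m => iter m.+1 hinv
  end.

(* Operator norm, for [g], of the linear map [fiber x -> fiber y] induced by a
   map [H] of the total space sending the fibre over [x] to the one over [y]. *)
Definition fiber_opnorm (R : realType) (M : topologicalType)
    (E : vector_bundle R M) (g : bundle_metric E)
    (H : total_space E -> total_space E) (x y : M) : R :=
  sup [set r | exists (u : fiber E x) (w : fiber E y),
    [/\ g x u u <= 1, H (fiber_incl E x u) = fiber_incl E y w &
        r = Num.sqrt (g y w w)]].

Definition quasiconformal_distortion (R : realType) (n : nat)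
    (M : manifold R n) (f : diffeo M) (E : vector_bundle R M)
    (g : bundle_metric E) (F : linear_cocycle E f) (x : M) (k : int) : R :=
  let y := iterz f (diffeo_inv f) k x in
  fiber_opnorm g (iterz (cocycle_map F) (cocycle_inv F) k) x y *
  fiber_opnorm g (iterz (cocycle_inv F) (cocycle_map F) k) y x.

Definition uniformly_quasiconformal (R : realType) (n : nat)
    (M : manifold R n) (f : diffeo M) (E : vector_bundle R M)
    (g : bundle_metric E) (F : linear_cocycle E f) : Prop :=
  exists K : R, forall x k, quasiconformal_distortion g F x k <= K.

(** * Conformal structures on a vector space *)

Record conformal (R : realType) (V : vectType R) := Conformal {
  conf_class :> set (V -> V -> R);
  conf_classP : exists b : {dot V for idfun},
    conf_class = [set (fun u v => k * b u v) | k in [set k : R | 0 < k]] }.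

(* Row convention: row [i] holds the coordinates of the image of [e_i]. *)
Definition mx_in (R : realType) (V : vectType R) (d : nat)
    (e : d.-tuple V) (A : 'End(V)) : 'M[R]_d :=
  \matrix_(i, j) coord e j (A (tnth e i)).

Definition lfun_det (R : realType) (V : vectType R) (A : 'End(V)) : R :=
  \det (mx_in (vbasis {:V}) A).

(* The unique operator of determinant 1 such that [g (A u) v] is in the class
   [c]; it is symmetric and positive definite for [g]. *)
Definition conf_op (R : realType) (V : vectType R) (g : {dot V for idfun})
    (c : conformal V) : 'End(V) :=
  xget \1%VF
    [set A : 'End(V) | lfun_det A = 1 /\ conf_class c (fun u v => g (A u) v)].

(* The matrix functions below are meant on symmetric positive definite matrices
   of determinant 1, on which the sets passed to [get] are nonempty and the
   distance does not depend on the choice made. *)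

Definition gl_act (R : realType) (d : nat) (X C : 'M[R]_d) : 'M[R]_d :=
  (\det (X^T *m X) `^ (- d%:R^-1)) *: (X^T *m C *m X).

(* Eigenvalues counted with multiplicity. *)
Definition eigenvalues (R : realType) (d : nat) (C : 'M[R]_d) : 'rV[R]_d :=
  get [set l : 'rV[R]_d | char_poly C = \prod_i ('X - (l 0 i)%:P)].

Definition spd_dist1 (R : realType) (d : nat) (C : 'M[R]_d) : R :=
  Num.sqrt d%:R / 2 * Num.sqrt (\sum_i ln (eigenvalues C 0 i) ^+ 2).

Definition spd_dist (R : realType) (d : nat) (C1 C2 : 'M[R]_d) : R :=
  spd_dist1 (gl_act
    (get [set X : 'M[R]_d | X \in unitmx /\ gl_act X C1 = 1%:M]) C2).

Definition orthonormal_basis (R : realType) (V : vectType R)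
    (g : {dot V for idfun}) : (\dim {:V}).-tuple V :=
  xget (vbasis {:V}) [set e : (\dim {:V}).-tuple V | basis_of {:V} e /\
    forall i j, g (tnth e i) (tnth e j) = (i == j)%:R].

Definition conf_dist (R : realType) (V : vectType R) (g : {dot V for idfun})
    (c1 c2 : conformal V) : R :=
  let e := orthonormal_basis g in
  spd_dist (mx_in e (conf_op g c1)) (mx_in e (conf_op g c2)).

Definition pullback (R : realType) (V W : vectType R) (L : V -> W)
    (c : set (W -> W -> R)) : set (V -> V -> R) :=
  [set (fun u v => b (L u) (L v)) | b in c].

(** * Conformal structures on a bundle *)

Definition conformal_structure (R : realType) (M : topologicalType)
    (E : vector_bundle R M) := forall x, conformal (fiber E x).

Definition continuous_structure (R : realType) (M : topologicalType)
    (E : vector_bundle R M) (g : bundle_metric E)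
    (tau : conformal_structure E) : Prop :=
  forall (t : trivialization E) (i j : 'I_(triv_rank t)),
    {within triv_dom t, continuous (fun x =>
      mx_in (triv_frame t x) (conf_op (g x) (tau x)) i j)}.

(* Borel measurability; [<<s open >>] is spelled out since the library's
   [g_sigma_algebraType] needs a pointed space. *)
Definition measurable_structure (R : realType) (M : topologicalType)
    (E : vector_bundle R M) (g : bundle_metric E)
    (tau : conformal_structure E) : Prop :=
  forall (t : trivialization E) (i j : 'I_(triv_rank t)) (B : set R),
    measurable B ->
    <<s @open M >> (triv_dom t `&`
      (fun x => mx_in (triv_frame t x) (conf_op (g x) (tau x)) i j) @^-1` B).

Definition bounded_structure (R : realType) (M : topologicalType)
    (E : vector_bundle R M) (g : bundle_metric E)
    (tau : conformal_structure E) : Prop :=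
  exists2 tau0 : conformal_structure E, continuous_structure g tau0 &
    exists K : R, forall x, conf_dist (g x) (tau x) (tau0 x) <= K.

Definition preserves_structure (R : realType) (M : topologicalType)
    (E : vector_bundle R M) (f : M -> M) (F : linear_cocycle E f)
    (tau : conformal_structure E) : Prop :=
  forall x, pullback (F x) (tau (f x)) = tau x.

(* Main.v *)
Require Import Defs.
From HB Require Import structures.
From mathcomp Require Import all_boot all_order all_algebra.
From mathcomp Require Import sesquilinear spectral complex.
From mathcomp Require Import all_classical all_reals all_analysis.
From mathcomp Require Import measurable_realfun.
From mathcomp Require Import ring lra.

(** An invariant conformal structure is found by choosing, in every fibre, a
    center of the family of all the pull-backs of the background metric by the
    iterates [F^k], [k] in [Z]. The map [F_x] carries the family at [x] to the
    one at [f x], up to a shift of the index [k], so that any center that is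
    natural under linear isomorphisms is invariant.

    The center is of Loewner type. In a basis, let [C_k] be the Gram matrices
    of the pull-backs and [n] the rank. A positive definite [P] has dilatation
    at most [s] when
      [P(v)^n / det P <= s * C_k(v)^n / det C_k] for all [k] and [v];
    this depends only on the conformal classes of [P] and of the [C_k], and is
    unchanged by a common congruence. A center is a [P] of least dilatation. It
    exists by compactness ([center_exists]), and it is unique up to scale
    ([is_center_proportional]): the determinant is strictly log-concave
    ([posdef_det_mid]), so the midpoint of two distinct minimizers with the same
    determinant would have a smaller dilatation. A congruence carries centers
    to centers ([is_center_congr]); with uniqueness this gives invariance
    ([center_structure_preserved]).

    Quasiconformality with constant [K] says that the metric itself has
    dilatation at most [K^(2n)] ([metric_admissible]). The center does at least
    as well; comparing it with [C_0], which is the metric, bounds its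
    eigenvalues in an orthonormal basis, hence its distance to the class of the
    metric ([center_structure_dist_le]). This bound depends on the rank, which
    is bounded since the base is compact ([bounded_rank]).

    For measurability, the [C_k] depend continuously on the base point
    ([gram_pulled_metric_cvg]). The existence of a [P] of dilatation at most [s]
    satisfying a given closed condition is a closed condition on the family:
    it is a projection along a compact set ([feasible_closed]). An entry of the
    normalized center is at most [c] exactly when, for every rational [s],
    dilatation [s] is attained under this additional constraint as soon as it is
    attained at all ([center_mem_closed]). Hence the set where this holds is the
    complement of a countable union of differences of open sets. *)

Set Implicit Arguments.
Unset Strict Implicit.
Unset Printing Implicit Defensive.

Import Order.TTheory GRing.Theory Num.Theory.
Import numFieldNormedType.Exports.

Local Open Scope classical_set_scope.
Local Open Scope ring_scope.

(** * Positive definite matrices *)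

Lemma char_poly_conj (F : fieldType) n (P D : 'M[F]_n) : P \in unitmx ->
  char_poly (invmx P *m D *m P) = char_poly D.
Proof.
move=> uP; pose Q := map_mx polyC P.
have uQ : Q \in unitmx by rewrite map_unitmx.
rewrite /char_poly.
have -> : char_poly_mx (invmx P *m D *m P) = invmx Q *m char_poly_mx D *m Q.
  rewrite /char_poly_mx !map_mxM /= mulmxBr mulmxBl map_invmx.
  by rewrite scalar_mxC mulmxKV.
by rewrite !det_mulmx mulrAC -det_mulmx mulVmx // det1 mul1r.
Qed.

Section PositiveDefinite.
Context {R : realType}.

Definition qf n (A : 'M[R]_n) (v : 'rV[R]_n) : R := (v *m A *m v^T) 0 0.

Definition posdef n (A : 'M[R]_n) :=
  A^T = A /\ forall v, v != 0 -> 0 < qf A v.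

(** Over [R[i]] a real symmetric matrix is hermitian, hence unitarily
    diagonalizable with real eigenvalues. The clause on constant spectra is what
    remains of diagonalizability in the equality case of [posdef_det_mid]. *)
Lemma symmx_spectrum n (A : 'M[R]_n) : A^T = A ->
  exists l : 'rV[R]_n, char_poly A = \prod_i ('X - (l 0 i)%:P) /\
    forall c, (forall i, l 0 i = c) -> A = c%:M.
Proof.
move=> symA; pose AC := map_mx (real_complex R) A.
have realAC : AC \is a realmx.
  by apply/mxOverP => i j; rewrite mxE; apply/complex_realP; exists (A i j).
have hermAC : AC \is hermsymmx.
  apply: realsym_hermsym realAC; apply/is_hermitianmxP.
  by rewrite expr0 scale1r map_mx_id // /AC map_trmx symA.
have /hermitian_normalmx/orthomx_spectralP eqA := hermAC.
have /mxOverP reald := hermitian_spectral_diag_real hermAC.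
pose P := spectralmx AC; have unitP : P \in unitmx by exact: spectral_unit.
pose l : 'rV[R]_n := \row_i complex.Re (spectral_diag AC 0 i).
have lE i : real_complex R (l 0 i) = spectral_diag AC 0 i.
  by rewrite mxE RRe_real.
exists l; split.
- apply: (map_poly_inj (real_complex R)).
  rewrite map_char_poly -/AC rmorph_prod /=.
  under eq_bigr => i _ do
    rewrite rmorphB /= map_polyX map_polyC /= lE.
  rewrite {1}eqA.
  rewrite char_poly_conj // char_poly_trig ?diag_mx_is_trig //.
  by apply: eq_bigr => i _; rewrite mxE eqxx mulr1n.
- move=> c lc; apply: (map_mx_inj (f := real_complex R)).
  rewrite -/AC eqA map_scalar_mx.
  suff -> : diag_mx (spectral_diag AC) = (real_complex R c)%:M.
    by rewrite scalar_mxC mulmxKV.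
  apply/matrixP => i j; rewrite !mxE -(lE i) lc.
  done.
Qed.

(** The left-hand side is, up to sign, the value at [- c] of the
    characteristic polynomial. *)
Lemma det_shift_spectrum n (A : 'M[R]_n) (l : 'rV[R]_n) c :
  char_poly A = \prod_i ('X - (l 0 i)%:P) ->
  \det (A + c%:M) = \prod_i (l 0 i + c).
Proof.
move=> lA.
have -> : A + c%:M = - ((- c)%:M - A).
  by rewrite raddfN /= opprB opprK.
have -> : (- c)%:M - A = map_mx (horner_eval (- c)) (char_poly_mx A).
  apply/matrixP => i j; rewrite !mxE /horner_eval hornerD hornerN hornerC.
  by rewrite hornerMn hornerX.
rewrite -scaleN1r detZ det_map_mx -/(char_poly A) lA /= horner_evalE.
rewrite horner_prod.
rewrite -[n in (-1) ^+ n]card_ord -prodr_const -big_split /=.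
by apply: eq_bigr => i _; rewrite !hornerE; ring.
Qed.

Lemma char_poly_root_spectrum n (A : 'M[R]_n) (l : 'rV[R]_n) i :
  char_poly A = \prod_i ('X - (l 0 i)%:P) ->
  exists2 v : 'rV[R]_n, v != 0 & v *m A = l 0 i *: v.
Proof.
move=> lA; have : root (char_poly A) (l 0 i).
  by rewrite lA /root horner_prod (bigD1 i) //= hornerXsubC subrr mul0r.
by rewrite -eigenvalue_root_char => /eigenvalueP [v vA v0]; exists v.
Qed.

Lemma qfZ n (A : 'M[R]_n) c v : qf (c *: A) v = c * qf A v.
Proof. by rewrite /qf -scalemxAr -scalemxAl mxE. Qed.

Lemma qfD n (A B : 'M[R]_n) v : qf (A + B) v = qf A v + qf B v.
Proof. by rewrite /qf mulmxDr mulmxDl mxE. Qed.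

Lemma qf0 n (A : 'M[R]_n) : qf A 0 = 0.
Proof. by rewrite /qf !mul0mx mxE. Qed.

Lemma qf_congr n (X A : 'M[R]_n) v : qf (X *m A *m X^T) v = qf A (v *m X).
Proof. by rewrite /qf trmx_mul !mulmxA. Qed.

Lemma qf1E n (v : 'rV[R]_n) : qf 1%:M v = \sum_i v 0 i ^+ 2.
Proof.
by rewrite /qf mulmx1 mxE; apply: eq_bigr => i _; rewrite mxE expr2.
Qed.

Lemma qf1_gt0 n (v : 'rV[R]_n) : v != 0 -> 0 < qf 1%:M v.
Proof.
move=> /rV0Pn [i vi]; rewrite qf1E (bigD1 i) //= ltr_pwDl //.
  by rewrite exprn_even_gt0.
by apply: sumr_ge0 => j _; exact: sqr_ge0.
Qed.

Lemma qf_eigen n (A : 'M[R]_n) c v : v *m A = c *: v ->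
  qf A v = c * qf 1%:M v.
Proof. by move=> vA; rewrite /qf vA mulmx1 -scalemxAl mxE. Qed.

Lemma posdef1 n : posdef (1%:M : 'M[R]_n).
Proof. by split; [rewrite trmx1 | exact: qf1_gt0]. Qed.

Lemma posdef_ge0 n (A : 'M[R]_n) v : posdef A -> 0 <= qf A v.
Proof.
by move=> [_ pA]; have [->|/pA/ltW//] := eqVneq v 0; rewrite qf0.
Qed.

Lemma posdefZ n (A : 'M[R]_n) c : 0 < c -> posdef A -> posdef (c *: A).
Proof.
move=> c0 [sA pA]; split; first by rewrite linearZ /= sA.
by move=> v /pA; rewrite qfZ; exact: mulr_gt0.
Qed.

Lemma posdefD n (A B : 'M[R]_n) : posdef A -> posdef B -> posdef (A + B).
Proof.
move=> [sA pA] [sB pB]; split; first by rewrite linearD /= sA sB.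
by move=> v v0; rewrite qfD addr_gt0 ?pA ?pB.
Qed.

Lemma posdef_congr n (X A : 'M[R]_n) : X \in unitmx ->
  posdef A -> posdef (X *m A *m X^T).
Proof.
move=> uX [sA pA]; split; first by rewrite !trmx_mul trmxK sA mulmxA.
move=> v v0; rewrite qf_congr pA //; apply: contraNneq v0 => vX0.
by rewrite -(mulmxK uX v) vX0 mul0mx.
Qed.

Lemma posdef_spectrum n (A : 'M[R]_n) (l : 'rV[R]_n) : posdef A ->
  char_poly A = \prod_i ('X - (l 0 i)%:P) -> forall i, 0 < l 0 i.
Proof.
move=> [_ pA] lA i; have [v v0 vA] := char_poly_root_spectrum i lA.
by have := pA v v0; rewrite (qf_eigen vA) pmulr_lgt0 ?qf1_gt0.
Qed.

Lemma spectrum_le n (A : 'M[R]_n) (l : 'rV[R]_n) c :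
  (forall v, qf A v <= c * qf 1%:M v) ->
  char_poly A = \prod_i ('X - (l 0 i)%:P) -> forall i, l 0 i <= c.
Proof.
move=> Ac lA i; have [v v0 vA] := char_poly_root_spectrum i lA.
by have := Ac v; rewrite (qf_eigen vA) ler_pM2r ?qf1_gt0.
Qed.

Lemma det_spectrum n (A : 'M[R]_n) (l : 'rV[R]_n) :
  char_poly A = \prod_i ('X - (l 0 i)%:P) -> \det A = \prod_i l 0 i.
Proof.
move=> /(det_shift_spectrum 0); rewrite raddf0 addr0 => ->.
by apply: eq_bigr => i _; rewrite addr0.
Qed.

Lemma posdef_det_gt0 n (A : 'M[R]_n) : posdef A -> 0 < \det A.
Proof.
move=> pA; have [l [lA _]] := symmx_spectrum pA.1.
by rewrite (det_spectrum lA) prodr_gt0 // => i _; exact: posdef_spectrum lA i.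
Qed.

Lemma posdef_unit n (A : 'M[R]_n) : posdef A -> A \in unitmx.
Proof. by move=> /posdef_det_gt0 d0; rewrite unitmxE unitfE gt_eqF. Qed.

(** Cholesky's argument: the positive upper left entry clears the first row
    and column, and induction applies to the Schur complement. *)
Lemma posdef_congr1 n (A : 'M[R]_n) : posdef A ->
  exists2 X, X \in unitmx & X *m A *m X^T = 1%:M.
Proof.
elim: n A => [A _|n IH A].
  by exists 1%:M; [exact: unitmx1 | apply/matrixP => -[]].
rewrite -[n.+1]/(1 + n)%N in A * => -[sA pA].
have sD : (drsubmx A)^T = drsubmx A by rewrite trmx_drsub sA.
have sU : (ursubmx A)^T = dlsubmx A by rewrite trmx_ursub sA.
pose a := A (lshift n 0) (lshift n 0).
have eA : A = block_mx a%:M (ursubmx A) (ursubmx A)^T (drsubmx A).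
  rewrite sU -[LHS]submxK; congr block_mx.
  by apply/matrixP => i j; rewrite !ord1 !mxE eqxx mulr1n.
have a0 : 0 < a.
  have := pA (row_mx 1%:M 0); rewrite /qf eA mul_row_block tr_row_mx.
  rewrite mul_row_col !mul1mx !mul0mx !addr0 trmx0 mulmx0 addr0 trmx1 mulmx1.
  rewrite mxE mulr1n; apply; apply/rV0Pn; exists (lshift n 0).
  by rewrite row_mxEl mxE oner_eq0.
pose r := ursubmx A.
(* elimination of the first row and column *)
pose X0 : 'M[R]_(1 + n) := block_mx 1%:M 0 (- a^-1 *: r^T) 1%:M.
have uX0 : X0 \in unitmx.
  by rewrite unitmxE det_lblock !det1 mulr1 unitr1.
pose S := drsubmx A - a^-1 *: (r^T *m r).
have eX0 : X0 *m A *m X0^T = block_mx a%:M 0 0 S.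
  rewrite {1}eA /X0 -/r tr_block_mx !trmx1 trmx0 linearZ /= trmxK.
  rewrite !mulmx_block !mul1mx !mul0mx !mulmx1 !mulmx0 !addr0.
  rewrite -!scalemxAl -!scalemxAr mul_mx_scalar mul_scalar_mx !scalerA.
  rewrite !mulNr mulVf ?gt_eqF // !scaleN1r !addNr mul0mx scaler0 add0r.
  by rewrite scaleNr addrC.
have [_ pXA] := posdef_congr uX0 (conj sA pA).
have pS : posdef S.
  split; first by rewrite /S linearB /= linearZ /= trmx_mul trmxK sD.
  move=> v v0; have := pXA (row_mx 0 v).
  rewrite eX0 /qf mul_row_block tr_row_mx.
  rewrite mul_row_col !(mul0mx, mulmx0, add0r, addr0, trmx0).
  apply; apply: contraNneq v0 => /(congr1 rsubmx).
  by rewrite row_mxKr linear0 => ->.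
have [Y uY YS] := IH S pS.
pose D : 'M[R]_(1 + n) := block_mx ((Num.sqrt a)^-1)%:M 0 0 Y.
have sa0 : (Num.sqrt a) != 0 by rewrite gt_eqF // sqrtr_gt0.
exists (D *m X0).
  rewrite unitmx_mul uX0 andbT unitmxE det_lblock det_scalar unitrM -unitmxE uY.
  by rewrite unitfE expf_neq0 // invr_neq0.
rewrite trmx_mul !mulmxA -[D *m X0 *m A]mulmxA -[D *m _ *m X0^T]mulmxA eX0.
rewrite /D tr_block_mx !trmx0 tr_scalar_mx !mulmx_block.
rewrite !mul0mx !mulmx0 !addr0 !add0r YS !mul0mx -!scalar_mxM.
rewrite -{2}(sqr_sqrtr (ltW a0)) expr2 mulKf // divff //.
by rewrite -scalar_mx_block.
Qed.

Lemma det_congr n (X A : 'M[R]_n) :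
  \det (X *m A *m X^T) = \det X ^+ 2 * \det A.
Proof. by rewrite !det_mulmx det_tr mulrAC expr2. Qed.

(** A congruence sending [G] to the identity leaves a matrix whose
    eigenvalues are at most [c]. *)
Lemma posdef_det_le n (A G : 'M[R]_n) c : posdef A -> posdef G ->
  (forall v, qf A v <= c * qf G v) -> \det A <= c ^+ n * \det G.
Proof.
move=> pA pG AG; have [X uX XG] := posdef_congr1 pG.
have pB := posdef_congr uX pA; have [l [lB _]] := symmx_spectrum pB.1.
have dX : 0 < \det X ^+ 2.
  by rewrite exprn_even_gt0 //= -unitfE -unitmxE.
rewrite -(ler_pM2l dX) mulrCA -!det_congr XG det1 mulr1 (det_spectrum lB).
rewrite -[n in _ ^+ n]card_ord -prodr_const.
apply: ler_prod => i _; rewrite ltW ?(posdef_spectrum pB lB) //=.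
apply: spectrum_le lB i => v; rewrite qf_congr.
by rewrite -XG qf_congr.
Qed.

(** Strict log-concavity of the determinant. After a congruence [A] is the
    identity and the eigenvalues [l] of [B] have product 1, so that the claim
    follows from [((1 + l) / 2)^2 >= l], an equality only for [l = 1]. *)
Lemma posdef_det_mid n (A B : 'M[R]_n) : posdef A -> posdef B ->
  \det A = \det B -> A != B -> \det A < \det (2^-1 *: (A + B)).
Proof.
move=> pA pB dAB AB; have [X uX XA] := posdef_congr1 pA.
have pS := posdef_congr uX pB; set S := X *m B *m X^T in pS.
have [l [lS lc]] := symmx_spectrum pS.1.
have dX : 0 < \det X ^+ 2.
  by rewrite exprn_even_gt0 //= -unitfE -unitmxE.
have dS : \prod_i l 0 i = 1.
  by rewrite -(det_spectrum lS) det_congr -dAB -det_congr XA det1.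
have l0 i : 0 < l 0 i by exact: posdef_spectrum lS i.
rewrite -(ltr_pM2l dX) -!det_congr XA det1 -scalemxAr -scalemxAl.
rewrite mulmxDr mulmxDl XA -/S addrC detZ (det_shift_spectrum 1 lS).
rewrite -[n in _ ^+ n]card_ord -prodr_const -big_split /=.
set p := \prod_i _.
have p0 : 0 < p by apply: prodr_gt0 => i _; have := l0 i; lra.
rewrite -(@ltr_pXn2r _ 2) ?nnegrE ?ler01 ?(ltW p0) // expr1n.
have pE : p ^+ 2 = \prod_i (1 + (l 0 i - 1) ^+ 2 / (4 * l 0 i)).
  have dV : \prod_i (l 0 i)^-1 = 1 by rewrite prodfV dS invr1.
  transitivity (p ^+ 2 * \prod_i (l 0 i)^-1); first by rewrite dV mulr1.
  rewrite -prodrXl -big_split /=.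
  by apply: eq_bigr => i _; have := l0 i => li; field; rewrite gt_eqF.
have [i li] : exists i, l 0 i != 1.
  apply: contrapT => /forallNP l1; move/eqP: AB; apply.
  have /lc S1 : forall i, l 0 i = 1 by move=> i; apply/eqP/negPn/negP/l1.
  have uXT : X^T \in unitmx by rewrite unitmx_tr.
  apply: (can_inj (mulKmx uX)); apply: (can_inj (mulmxK uXT)).
  by rewrite XA -/S S1.
have t0 j : 0 <= (l 0 j - 1) ^+ 2 / (4 * l 0 j).
  by rewrite divr_ge0 ?sqr_ge0 // mulr_ge0 // ltW.
rewrite pE (bigD1 i) //=.
have ti : 1 < 1 + (l 0 i - 1) ^+ 2 / (4 * l 0 i).
  rewrite ltrDl; apply: divr_gt0; last exact: mulr_gt0.
  by rewrite exprn_even_gt0 //= subr_eq0.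
apply: (lt_le_trans ti); rewrite ler_peMr ?(le_trans ler01 (ltW ti)) //.
elim/big_ind: _ => // [x y x1 y1|j _]; first exact: mulr_ege1.
by rewrite lerDl.
Qed.

(** An isotropic vector [v] is in the kernel: [qf A (v + t *: w)] cannot be
    nonnegative for all [t] unless its linear term in [t] vanishes. *)
Lemma posdef_psd n (A : 'M[R]_n) : A^T = A -> (forall v, 0 <= qf A v) ->
  \det A != 0 -> posdef A.
Proof.
move=> sA A0 dA; have uA : A \in unitmx by rewrite unitmxE unitfE.
have [l [lA _]] := symmx_spectrum sA.
split=> // v v0; rewrite lt_neqAle A0 andbT; apply: contraNneq v0 => qv0.
apply/eqP; rewrite -(mulmxK uA v); suff -> : v *m A = 0 by rewrite mul0mx.
apply/rowP => j; rewrite [RHS]mxE; set w := (delta_mx 0 j : 'rV[R]_n).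
set b := (v *m A) 0 j; set c := qf A w.
have vw : (v *m A *m w^T) 0 0 = b by rewrite trmx_delta -colE mxE.
have wv : (w *m A *m v^T) 0 0 = b.
  have : (w *m A *m v^T)^T = v *m A *m w^T.
    by rewrite !trmx_mul trmxK sA mulmxA.
  by move=> /matrixP/(_ 0 0); rewrite mxE vw.
have quad t : qf A (v + t *: w) = 2 * t * b + t ^+ 2 * c.
  rewrite /qf linearD /= linearZ /= !mulmxDl !mulmxDr -!scalemxAl -!scalemxAr.
  do 3 rewrite [(_ + _ : 'M[R]_1) 0 0]mxE.
  rewrite ![(_ *: _ : 'M[R]_1) 0 0]mxE vw wv.
  by rewrite -/(qf A v) -qv0 -/(qf A w) -/c; ring.
have c0 : 0 <= c by exact: A0.
(* this value of [t] makes the quadratic polynomial negative unless [b = 0];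
   adding 1 to [c] avoids a division by 0 *)
have := A0 (v + (- b / (c + 1)) *: w); rewrite quad => q0.
have c1 : 0 < c + 1 by lra.
have : 0 <= - b ^+ 2 * (c + 2).
  set q := (X in 0 <= X) in q0.
  have -> : - b ^+ 2 * (c + 2) = q * (c + 1) ^+ 2.
    by rewrite /q; field; rewrite gt_eqF.
  by rewrite mulr_ge0 ?sqr_ge0.
move=> b0; apply/eqP; rewrite -sqrf_eq0 eq_le sqr_ge0 andbT; nra.
Qed.

(** The reason why operator norms are finite: all quadratic forms are
    controlled by a positive definite one. *)
Lemma posdef_dominates n (G C : 'M[R]_n) : posdef G ->
  exists2 c, 0 <= c & forall v, qf C v <= c * qf G v.
Proof.
move=> pG; have [X uX XG] := posdef_congr1 pG.
pose D := X *m C *m X^T.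
exists (\sum_j \sum_i `|D i j|).
  by do 2!apply: sumr_ge0 => ? _.
move=> v; have [w ->] : exists w, v = w *m X.
  by exists (v *m invmx X); rewrite mulmxKV.
rewrite -!qf_congr XG -/D /qf mulmx1 mxE mulr_suml.
have wi i : w 0 i ^+ 2 <= (w *m w^T) 0 0.
  rewrite -[w in w *m _]mulmx1 -/(qf _ _) qf1E (bigD1 i) //= lerDl.
  by apply: sumr_ge0 => j _; exact: sqr_ge0.
apply: ler_sum => j _.
rewrite mxE !mulr_suml; apply: ler_sum => i _.
rewrite mxE; apply: (le_trans (ler_norm _)); rewrite !normrM.
rewrite mulrAC mulrC ler_wpM2l //.
have : 0 <= (`|w 0 i| - `|w 0 j|) ^+ 2 by exact: sqr_ge0.
have := wi i; have := wi j; rewrite -[w 0 i ^+ 2]real_normK ?num_real //.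
rewrite -[w 0 j ^+ 2]real_normK ?num_real // [(w^T) j 0]mxE; nra.
Qed.

End PositiveDefinite.

(** * Limits and compactness in spaces of matrices *)

Section Convergence.
Context {R : realType} {T : Type} (F : set_system T) {FF : Filter F}.

Lemma mx_cvg m n (f : T -> 'M[R]_(m, n)) (M : 'M[R]_(m, n)) :
  (forall i j, f t i j @[t --> F] --> M i j) -> f @ F --> M.
Proof.
move=> fM A [P MP PA].
have : \forall t \near F, forall i j, P i j (f t i j).
  by do 2!(apply: filter_forall => ?); exact: fM (MP _ _).
by apply: filterS => t Pt; apply: PA.
Qed.

Lemma cvg_coord m n (f : T -> 'M[R]_(m, n)) (M : 'M[R]_(m, n)) i j :
  f @ F --> M -> f t i j @[t --> F] --> M i j.
Proof. move=> fM; exact: (cvg_comp _ _ fM (@coord_continuous R m n i j M)). Qed.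

Lemma cvgX (f : T -> R) (a : R) n :
  f @ F --> a -> f t ^+ n @[t --> F] --> a ^+ n.
Proof. by move=> fa; exact: (cvg_comp _ _ fa (@exprn_continuous R n a)). Qed.

Lemma cvg_sumr (I : Type) (r : seq I) (f : I -> T -> R) (a : I -> R) :
  (forall i, f i @ F --> a i) ->
  \sum_(i <- r) f i t @[t --> F] --> \sum_(i <- r) a i.
Proof.
by move=> fa; apply: cvg_big => //; exact: add_continuous.
Qed.

Lemma cvg_prodr (I : Type) (r : seq I) (f : I -> T -> R) (a : I -> R) :
  (forall i, f i @ F --> a i) ->
  \prod_(i <- r) f i t @[t --> F] --> \prod_(i <- r) a i.
Proof.
by move=> fa; apply: cvg_big => //; exact: mul_continuous.
Qed.

Lemma cvg_mulmx m n p (f : T -> 'M[R]_(m, n)) (g : T -> 'M[R]_(n, p))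
    (A : 'M[R]_(m, n)) (B : 'M[R]_(n, p)) :
  f @ F --> A -> g @ F --> B -> f t *m g t @[t --> F] --> A *m B.
Proof.
move=> fA gB; apply: mx_cvg => i j; rewrite mxE.
under eq_fun do rewrite mxE.
by apply: cvg_sumr => k; apply: cvgM; exact: cvg_coord.
Qed.

Lemma cvg_det n (f : T -> 'M[R]_n) (A : 'M[R]_n) :
  f @ F --> A -> \det (f t) @[t --> F] --> \det A.
Proof.
move=> fA; apply: cvg_sumr => s; apply: cvgM; first exact: cvg_cst.
by apply: cvg_prodr => i; exact: cvg_coord.
Qed.

Lemma cvg_adj n (f : T -> 'M[R]_n) (A : 'M[R]_n) :
  f @ F --> A -> \adj (f t) @[t --> F] --> \adj A.
Proof.
move=> fA; apply: mx_cvg => i j; rewrite mxE.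
under eq_fun do rewrite mxE.
apply: cvgM; first exact: cvg_cst.
apply: cvg_det; apply: mx_cvg => k l; rewrite !mxE.
by under eq_fun do rewrite !mxE; exact: cvg_coord.
Qed.

Lemma cvg_qf n (f : T -> 'M[R]_n) (A : 'M[R]_n) v :
  f @ F --> A -> qf (f t) v @[t --> F] --> qf A v.
Proof.
move=> fA; apply: (cvg_coord (f := fun t => v *m f t *m v^T)).
apply: cvg_mulmx; last exact: cvg_cst.
by apply: cvg_mulmx => //; exact: cvg_cst.
Qed.

End Convergence.

Lemma mx_compact {R : realType} m n (B : R) :
  compact [set P : 'M[R]_(m, n) | forall i j, `|P i j| <= B].
Proof.
pose K := [set v : 'rV[R]_(m * n) | forall l, `[- B, B]%classic (v 0 l)].
have cK : compact K.
  apply: (@rV_compact R _ (fun=> `[- B, B]%classic)) => l.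
  exact: segment_compact.
have -> : [set P : 'M[R]_(m, n) | forall i j, `|P i j| <= B] = vec_mx @` K.
  apply/seteqP; split=> [P PB|_ [v vK <-] i j] /=.
    exists (mxvec P); last exact: mxvecK.
    move=> l; case/mxvec_indexP: l => i j.
    by rewrite mxvecE /= in_itv /= -ler_norml.
  by rewrite mxE ler_norml; have := vK (mxvec_index i j); rewrite /= in_itv.
apply: continuous_compact cK; apply: continuous_subspaceT => v.
apply: (mx_cvg (F := nbhs v)) => i j; rewrite mxE.
under eq_fun do rewrite mxE.
exact: coord_continuous.
Qed.

(** * The center of a family of positive definite matrices *)

Section Center.
Context {R : realType} {n : nat}.
Implicit Types (C : int -> 'M[R]_n) (P Q : 'M[R]_n) (s : R).

(** The power [n] makes the condition homogeneous of degree 0 in [P] and in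
    each [C k]: it is about conformal classes, and no root of a determinant is
    needed to normalize them. *)
Definition admissible C s P := posdef P /\ forall k v,
  qf P v ^+ n * \det (C k) <= s * \det P * qf (C k) v ^+ n.

Definition is_center C P := exists s, admissible C s P /\
  forall s' P', admissible C s' P' -> s <= s'.

(** In dimension 0 the vector 0 does it, since [0 ^+ 0 = 1]; the statement
    spares the later lemmas this case. *)
Lemma posdef_witness :
  exists v : 'rV[R]_n, forall P, posdef P -> 0 < qf P v ^+ n.
Proof.
case: n => [|m]; first by exists 0 => P _; rewrite expr0.
exists (delta_mx 0 0) => P [_ pP]; apply/exprn_gt0/pP.
by apply/rV0Pn; exists 0; rewrite mxE !eqxx oner_eq0.
Qed.

Lemma admissible_gt0 C s P : posdef (C 0) -> admissible C s P -> 0 < s.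
Proof.
have [v v0] := posdef_witness => pC [pP /(_ 0 v)]; have dP := posdef_det_gt0 pP.
have := mulr_gt0 (v0 P pP) (posdef_det_gt0 pC) => x0 /(lt_le_trans x0).
by rewrite pmulr_lgt0 ?v0 // pmulr_lgt0.
Qed.

Lemma admissible_le C s s' P : (forall k, posdef (C k)) -> s <= s' ->
  admissible C s P -> admissible C s' P.
Proof.
move=> pC ss' [pP sP]; split=> // k v; apply: (le_trans (sP k v)).
rewrite ler_wpM2r ?exprn_ge0 ?posdef_ge0 // ler_wpM2r //.
exact/ltW/posdef_det_gt0.
Qed.

Lemma admissibleZ C s P c : 0 < c -> admissible C s P ->
  admissible C s (c *: P).
Proof.
move=> c0 [pP sP]; split=> [|k v]; first exact: posdefZ.
rewrite qfZ detZ exprMn.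
rewrite [leRHS](_ : _ = c ^+ n * (s * \det P * qf (C k) v ^+ n)); last by ring.
by rewrite -[leLHS]mulrA ler_pM2l ?exprn_gt0.
Qed.

Lemma admissible_congr C s P X : X \in unitmx -> admissible C s P ->
  admissible (fun k => X *m C k *m X^T) s (X *m P *m X^T).
Proof.
move=> uX [pP sP]; split=> [|k v]; first exact: posdef_congr.
rewrite !det_congr !qf_congr mulrCA.
rewrite [leRHS](_ : _ = \det X ^+ 2 *
  (s * \det P * qf (C k) (v *m X) ^+ n)); last by ring.
by rewrite ler_wpM2l ?sqr_ge0.
Qed.

Lemma congrKV X P : X \in unitmx ->
  invmx X *m (X *m P *m X^T) *m (invmx X)^T = P.
Proof.
move=> uX; rewrite !mulmxA mulVmx // mul1mx -mulmxA -trmx_mul mulVmx //.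
by rewrite trmx1 mulmx1.
Qed.

Lemma is_center_congr C P X : X \in unitmx -> is_center C P ->
  is_center (fun k => X *m C k *m X^T) (X *m P *m X^T).
Proof.
move=> uX [s [sP sm]]; exists s; split; first exact: admissible_congr.
move=> s' P'; rewrite -unitmx_inv in uX => /(admissible_congr uX).
rewrite unitmx_inv in uX; under [X in admissible X _ _]eq_fun do
  rewrite congrKV //.
exact: sm.
Qed.

(** The shift permutes [Z], so both families impose the same constraints. *)
Lemma is_center_shift C P : is_center C P -> is_center (fun k => C (k + 1)) P.
Proof.
move=> [s [[pP sP] sm]]; exists s; split; first by split.
move=> s' P' [pP' sP']; apply: (sm s' P'); split=> // k v.
by have := sP' (k - 1) v; rewrite subrK.
Qed.

(** The midpoint [S] of [P] and [Q] satisfies the same constraints, since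
    [qf S v] is at most the larger of [qf P v] and [qf Q v], but its determinant
    is larger: [s] can be lowered in the same proportion. *)
Lemma admissible_mid C s P Q : (forall k, posdef (C k)) ->
  admissible C s P -> admissible C s Q -> \det P = \det Q -> P != Q ->
  exists s' P', s' < s /\ admissible C s' P'.
Proof.
move=> pC sP sQ dPQ PQ; have s0 := admissible_gt0 (pC 0) sP.
case: sP sQ => [pP sP] [pQ sQ].
have dmid := posdef_det_mid pP pQ dPQ PQ; set S := 2^-1 *: (P + Q) in dmid.
have pS : posdef S by apply: posdefZ; [rewrite invr_gt0 | exact: posdefD].
have dS := posdef_det_gt0 pS; have dP := posdef_det_gt0 pP.
exists (s * \det P / \det S), S; split.
  by rewrite ltr_pdivrMr // ltr_pM2l.
split=> // k v; rewrite divfK ?gt_eqF //.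
have dS0 := ltW (posdef_det_gt0 (pC k)).
have qS m : qf P v <= m -> qf Q v <= m -> qf S v ^+ n <= m ^+ n.
  move=> Pm Qm; apply: lerXn2r; rewrite ?nnegrE ?posdef_ge0 //.
    exact: le_trans (posdef_ge0 v pP) Pm.
  by rewrite /S qfZ qfD; lra.
have [PQv|/ltW QPv] := leP (qf P v) (qf Q v).
- rewrite dPQ; apply: le_trans (sQ k v).
  by rewrite ler_wpM2r // qS.
- by apply: le_trans (sP k v); rewrite ler_wpM2r // qS.
Qed.

Lemma is_center_uniq C P Q : (forall k, posdef (C k)) -> is_center C P ->
  is_center C Q -> \det P = \det Q -> P = Q.
Proof.
move=> pC [s [sP sm]] [s' [sQ sm']] dPQ.
have ss' : s = s' by apply/eqP; rewrite eq_le (sm _ _ sQ) (sm' _ _ sP).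
apply/eqP/negPn/negP => PQ; rewrite -ss' in sQ.
have [t [S [ts /sm]]] := admissible_mid pC sP sQ dPQ PQ.
by rewrite leNgt ts.
Qed.

Lemma is_centerZ C P c : 0 < c -> is_center C P -> is_center C (c *: P).
Proof. by move=> c0 [s [sP sm]]; exists s; split; first exact: admissibleZ. Qed.

(** In dimension 0 every determinant is 1, hence the condition on [D]. *)
Lemma posdef_scale_det P D : posdef P -> 0 < D -> (n = 0 -> D = 1) ->
  exists2 c, 0 < c & \det (c *: P) = D.
Proof.
move=> /posdef_det_gt0 dP D0 nD; exists ((D / \det P) `^ n%:R^-1).
  by rewrite powR_gt0 // divr_gt0.
rewrite detZ; have [n0|n0] := eqVneq n 0.
  by rewrite nD // n0 in P dP *; rewrite expr0 det_mx00 mul1r.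
rewrite -powR_mulrn ?powR_ge0 // -powRrM mulVf ?pnatr_eq0 //.
by rewrite powRr1 ?divfK ?gt_eqF // ltW // divr_gt0.
Qed.

Lemma is_center_proportional C P Q : (forall k, posdef (C k)) ->
  is_center C P -> is_center C Q -> exists2 c, 0 < c & Q = c *: P.
Proof.
move=> pC cP cQ; have [s [[pP _] _]] := cP; have [t [[pQ _] _]] := cQ.
have [|c c0 dc] := posdef_scale_det pP (posdef_det_gt0 pQ).
  by move=> n0; move: Q {cQ pQ}; rewrite n0 => Q; exact: det_mx00.
exists c => //; apply: (is_center_uniq pC cQ _ (esym dc)).
exact: is_centerZ.
Qed.

(** Admissibility for [P] normalized by [det P = det (C 0)], spelled out by
    closed conditions only: positive semidefinite matrices with that determinant
    are definite. The constraint [Z] may involve [C 0] because the operator of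
    a conformal class with respect to the metric is [P *m invmx (C 0)]. *)
Definition feasible (Z : set ('M[R]_n * 'M[R]_n)) C s P :=
  [/\ P^T = P, forall v, 0 <= qf P v, \det P = \det (C 0),
    forall k v, qf P v ^+ n * \det (C k) <= s * \det (C 0) * qf (C k) v ^+ n &
    Z (P, C 0)].

Lemma feasibleP Z C s P : posdef (C 0) ->
  feasible Z C s P <-> [/\ admissible C s P, \det P = \det (C 0) & Z (P, C 0)].
Proof.
move=> /posdef_det_gt0 dC; split=> [[sP P0 dP sPC ZP]|[[pP sPC] dP ZP]].
  split=> //; split=> [|k v]; last by rewrite dP.
  by apply: posdef_psd; rewrite // dP gt_eqF.
split=> // [||k v]; first exact: pP.1; last by rewrite -dP.
by move=> v; exact: posdef_ge0.
Qed.

(** The constraint of index 0 bounds the quadratic form [P] by [C 0], and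
    polarization recovers its entries. *)
Lemma feasible_entry_le Z C s P i j : posdef (C 0) -> 1 <= s ->
  feasible Z C s P ->
  `|P i j| <= s * (qf (C 0) (delta_mx 0 i + delta_mx 0 j) +
                   qf (C 0) (delta_mx 0 i - delta_mx 0 j)).
Proof.
move=> pC s1 /(feasibleP Z s P pC) [[pP sPC] dP _].
have n0 : (0 < n)%N by exact: leq_trans (ltn_ord i).
have le_qf v : qf P v <= s * qf (C 0) v.
  have dC := posdef_det_gt0 pC.
  have := sPC 0 v; rewrite dP mulrAC ler_pM2r // => le_n.
  have C0 := posdef_ge0 v pC; have P0 := posdef_ge0 v pP.
  rewrite -(ler_pXn2r n0) ?nnegrE ?mulr_ge0 ?(le_trans ler01 s1) //.
  apply: (le_trans le_n); rewrite exprMn.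
  rewrite ler_wpM2r ?exprn_ge0 //. by rewrite ler_eXnr.
have le1 := le_qf (delta_mx 0 i + delta_mx 0 j).
have le2 := le_qf (delta_mx 0 i - delta_mx 0 j).
have ge1 := posdef_ge0 (delta_mx 0 i + delta_mx 0 j) pP.
have ge2 := posdef_ge0 (delta_mx 0 i - delta_mx 0 j) pP.
have : 4 * P i j = qf P (delta_mx 0 i + delta_mx 0 j) -
                   qf P (delta_mx 0 i - delta_mx 0 j).
  have PE k l : ((delta_mx 0 k : 'rV[R]_n) *m P *m
      (delta_mx 0 l : 'rV[R]_n)^T) 0 0 = P k l.
    by rewrite trmx_delta -colE -rowE !mxE.
  rewrite /qf [(_ + _)^T]linearD [(_ - _)^T]linearB /=.
  rewrite !(mulmxDl, mulmxDr, mulNmx, mulmxN).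
  have mD (A B : 'M[R]_1) : (A + B) 0 0 = A 0 0 + B 0 0 by rewrite mxE.
  have mN (A : 'M[R]_1) : (- A) 0 0 = - A 0 0 by rewrite mxE.
  rewrite !(mD, mN) !PE.
  have -> : P j i = P i j by rewrite -[in RHS]pP.1 mxE.
  by ring.
move=> PE; rewrite ler_norml mulrDr; lra.
Qed.

(** By [feasible_entry_le] the solutions near the limit stay in a fixed
    compact box; each point of the box violates one of the conditions at the
    limit, and then so do its neighbours for nearby parameters. *)
Lemma feasible_closed (T : Type) (F : set_system T) {FF : Filter F}
    (Ct : T -> int -> 'M[R]_n) (st : T -> R) C s Z : closed Z ->
  (\forall t \near F, forall k, posdef (Ct t k)) -> (forall k, posdef (C k)) ->
  (forall k, Ct t k @[t --> F] --> C k) -> st @ F --> s ->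
  ~ (exists P, feasible Z C s P) ->
  \forall t \near F, ~ exists P, feasible Z (Ct t) (st t) P.
Proof.
move=> clZ pCt pC CtC sts noP.
(* [feasible_entry_le] asks for a level that is at least 1, whence [`|r| + 1] *)
pose bound (D : 'M[R]_n) (r : R) i j := (`|r| + 1) *
  (qf D (delta_mx 0 i + delta_mx 0 j) + qf D (delta_mx 0 i - delta_mx 0 j)).
pose B := \sum_i \sum_j bound (C 0) s i j + 1.
have bounded : \forall t \near F, \sum_i \sum_j bound (Ct t 0) (st t) i j < B.
  have lt_B : \sum_i \sum_j bound (C 0) s i j < B by rewrite ltrDl.
  suff cvgB : \sum_i \sum_j bound (Ct t 0) (st t) i j @[t --> F] -->
      \sum_i \sum_j bound (C 0) s i j by exact: (cvgr_lt _ cvgB _ lt_B).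
  do 2!(apply: cvg_sumr => ?); apply: cvgM; last by apply: cvgD; exact: cvg_qf.
  by apply: cvgD; [exact: cvg_norm | exact: cvg_cst].
have /compact_near_coveringP covK := @mx_compact R n n B.
have {covK} cov : \forall t \near F,
    [set P : 'M[R]_n | forall i j, `|P i j| <= B] `<=`
      (fun P => ~ feasible Z (Ct t) (st t) P).
  apply: covK => P _; pose G := filter_prod (nbhs P) F.
  have FG : Filter G by exact: filter_prod_filter.
  have cvgP1 : fst @ G --> P by exact: cvg_fst.
  have cvgC k : Ct z.2 k @[z --> G] --> C k.
    by apply: (cvg_comp snd (Ct^~ k)); [exact: cvg_snd | exact: CtC].
  have cvgs : st z.2 @[z --> G] --> s.
    by apply: (cvg_comp snd st); [exact: cvg_snd | exact: sts].
  suff : \forall z \near G, ~ feasible Z (Ct z.2) (st z.2) z.1 by [].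
  have [sP|nsP] := pselect (P^T = P); last first.
    have [i [j nP]] : exists i j, P i j != P j i.
      apply: contrapT => noij; apply: nsP; apply/matrixP => i j; rewrite mxE.
      by apply/eqP/negPn/negP => nP; apply: noij; exists j, i.
    have cij : (fun z : 'M[R]_n * T => z.1 i j - z.1 j i) @ G -->
        P i j - P j i.
      by apply: cvgB; exact: cvg_coord.
    rewrite -subr_eq0 in nP; apply: filterS (cvgr_neq0 _ cij nP).
    by move=> z /eqP nz [sz _ _ _ _]; apply: nz; rewrite -{1}sz mxE subrr.
  have [P0|/existsNP [v /negP]] := pselect (forall v, 0 <= qf P v); last first.
    rewrite -ltNge => Pv.
    have cv : (fun z : 'M[R]_n * T => qf z.1 v) @ G --> qf P v by exact: cvg_qf.
    apply: filterS (cvgr_lt _ cv _ Pv).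
    by move=> z zv [_ /(_ v)]; rewrite leNgt zv.
  have [dP|/eqP ndP] := eqVneq (\det P) (\det (C 0)); last first.
    have cdet : (fun z : 'M[R]_n * T => \det z.1 - \det (Ct z.2 0)) @ G -->
        \det P - \det (C 0).
      by apply: cvgB; exact: cvg_det.
    have nd : \det P - \det (C 0) != 0 by rewrite subr_eq0; exact/eqP.
    apply: filterS (cvgr_neq0 _ cdet nd).
    by move=> z /eqP nz [_ _ dz _ _]; apply: nz; rewrite dz subrr.
  have [sPC|/existsNP [k /existsNP [v /negP]]] := pselect (forall k v,
      qf P v ^+ n * \det (C k) <= s * \det (C 0) * qf (C k) v ^+ n); last first.
    rewrite -ltNge -subr_gt0 => kv.
    have ckv : (fun z : 'M[R]_n * T => qf z.1 v ^+ n * \det (Ct z.2 k) -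
        st z.2 * \det (Ct z.2 0) * qf (Ct z.2 k) v ^+ n) @ G -->
        qf P v ^+ n * \det (C k) - s * \det (C 0) * qf (C k) v ^+ n.
      apply: cvgB; apply: cvgM.
      - by apply: cvgX; exact: cvg_qf.
      - exact: cvg_det.
      - by apply: cvgM => //; exact: cvg_det.
      - by apply: cvgX; exact: cvg_qf.
    apply: filterS (cvgr_gt _ ckv _ kv) => z.
    by rewrite subr_gt0 => zkv [_ _ _ /(_ k v)]; rewrite leNgt zkv.
  have nZ : (~` Z) (P, C 0) by move=> ZP; apply: noP; exists P; split.
  have : (fun z : 'M[R]_n * T => (z.1, Ct z.2 0)) @ G --> (P, C 0).
    exact: (@cvg_pair _ _ _ _ (nbhs P) (nbhs (C 0)) _ _ _ fst _ cvgP1 (cvgC 0)).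
  move=> /(_ (~` Z)) nearZ; have : nbhs (P, C 0) (~` Z).
    by apply: open_nbhs_nbhs; split=> //; rewrite openC.
  move=> /nearZ nearZ'.
  have {nearZ' nearZ} : \forall z \near G, ~ Z (z.1, Ct z.2 0) by exact: nearZ'.
  by apply: filterS => z nz [].
near=> t => -[P fP]; suff : ~ feasible Z (Ct t) (st t) P by [].
have pCtt : forall k, posdef (Ct t k) by near: t.
have covt := near cov t; apply: covt => // i j /=.
have st1 : 1 <= `|st t| + 1 by rewrite lerDr.
have fP' : feasible Z (Ct t) (`|st t| + 1) P.
  case/(feasibleP _ _ _ (pCtt 0)): fP => adm dP ZP.
  apply/(feasibleP _ _ _ (pCtt 0)); split=> //.
  by apply: (admissible_le pCtt _ adm); rewrite (le_trans (ler_norm _)) ?lerDl.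
apply: le_trans (feasible_entry_le i j (pCtt 0) st1 fP') _.
have bound0 k l : 0 <= bound (Ct t 0) (st t) k l.
  by rewrite /bound mulr_ge0 ?addr_ge0 ?posdef_ge0.
apply: (@le_trans _ _ (\sum_k \sum_l bound (Ct t 0) (st t) k l)).
  rewrite (bigD1 i) //= (bigD1 j) //= -addrA lerDl addr_ge0 //.
    by apply: sumr_ge0.
  by do 2!apply: sumr_ge0 => ? _.
by apply: ltW; near: t.
Unshelve. all: by end_near. Qed.

(** By [feasible_closed] for the constant family, the set of the levels [s]
    that are attained is closed, so it contains its infimum. *)
Lemma center_exists C : (forall k, posdef (C k)) ->
  (exists s P, admissible C s P) ->
  exists P, is_center C P /\ \det P = \det (C 0).
Proof.
move=> pC [s0 [P0 sP0]]; pose S := [set s | exists P, feasible setT C s P].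
have S_adm s P : admissible C s P -> S s.
  move=> sP; have [|c c0 dc] := posdef_scale_det sP.1 (posdef_det_gt0 (pC 0)).
    by move=> n0; move: (C 0); rewrite n0 => C0; exact: det_mx00.
  exists (c *: P); apply/(feasibleP _ _ _ (pC 0)); split=> //.
  exact: admissibleZ.
have S0 s : S s -> 0 < s.
  by move=> [P /(feasibleP _ _ _ (pC 0)) [/(admissible_gt0 (pC 0))]].
have infS : has_inf S.
  split; first by exists s0; exact: S_adm sP0.
  by exists 0 => s /S0/ltW.
have [P fP] : S (inf S).
  apply: contrapT => nS.
  have : \forall s \near inf S, ~ exists P, feasible setT C s P.
    apply: (@feasible_closed R (nbhs (inf S)) _ (fun=> C) id C (inf S) setT)
      => //; first exact: nearW.
    by move=> k; exact: cvg_cst.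
  move=> /nbhs_ballP [e /= e0 nearS].
  have [s Ss sS] := inf_adherent e0 infS.
  apply: (nearS s); last exact: Ss.
  rewrite /ball /= distrC ger0_norm ?subr_ge0 ?inf_lbound //;
    last exact: infS.2.
  by rewrite ltrBlDl.
have [sP dP _] := (feasibleP setT (inf S) P (pC 0)).1 fP.
exists P; split=> //; exists (inf S); split=> // s' P' /S_adm Ss'.
by apply: inf_lbound Ss'; exact: infS.2.
Qed.

(** For the converse, the levels [q] above the least one [s] are attained
    under the constraint [Z]; by closedness so is [s] itself, and by uniqueness
    the solution found there is [P]. *)
Lemma center_mem_closed C P Z : (forall k, posdef (C k)) -> closed Z ->
  is_center C P -> \det P = \det (C 0) ->
  Z (P, C 0) <-> forall q : rat,
    (exists P', feasible setT C (ratr q) P') ->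
    exists P', feasible Z C (ratr q) P'.
Proof.
move=> pC clZ cP dP; have [s [sP sm]] := cP; split=> [ZP q [P' fP']|allq].
  exists P; apply/(feasibleP _ _ _ (pC 0)); split=> //.
  apply: admissible_le sP => //.
  by apply: (sm _ P'); case/feasibleP: fP'.
apply: contrapT => nZ.
have noP : ~ exists P', feasible Z C s P'.
  move=> [P' /(feasibleP _ _ _ (pC 0)) [sP' dP' ZP']]; apply: nZ.
  rewrite (is_center_uniq pC cP (_ : is_center C P')) ?dP ?dP' //.
  by exists s.
have : \forall s' \near s, ~ exists P', feasible Z C s' P'.
  apply: (@feasible_closed R (nbhs s) _ (fun=> C) id C s Z) => // [|k].
    exact: nearW.
  exact: cvg_cst.
move=> /nbhs_ballP [e /= e0 nears].
have [|q] := @rat_in_itvoo _ s (s + e); first by rewrite ltrDl.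
rewrite in_itv /= => /andP[sq qs]; apply: (nears (ratr q)).
  by rewrite /ball /= distrC gtr0_norm ?subr_gt0 // ltrBlDl.
apply: allq; exists P; apply/(feasibleP _ _ _ (pC 0)); split=> //.
exact: admissible_le (ltW sq) sP.
Qed.

End Center.

(** * Inner products and their Gram matrices *)

Section Forms.
Context {R : realType}.
Implicit Types V W : vectType R.

Definition lincomb V n (e : n.-tuple V) (a : 'rV[R]_n) : V :=
  \sum_i a 0 i *: tnth e i.

Definition coords V n (e : n.-tuple V) (v : V) : 'rV[R]_n :=
  \row_i coord e i v.

Lemma lincombP V n (e : n.-tuple V) : linear (lincomb e).
Proof.
move=> c u v; rewrite /lincomb scaler_sumr -big_split /=.
by apply: eq_bigr => i _; rewrite !mxE scalerDl scalerA.
Qed.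

Lemma coordsP V n (e : n.-tuple V) : linear (coords e).
Proof. by move=> c u v; apply/rowP => i; rewrite !mxE linearP. Qed.

Section Basis.
Context {V : vectType R} {n : nat} {e : n.-tuple V}.
Hypothesis be : basis_of fullv e.

Lemma coordsK : cancel (coords e) (lincomb e).
Proof.
move=> v; rewrite [RHS](coord_basis be) ?memvf //.
by apply: eq_bigr => i _; rewrite mxE (tnth_nth 0).
Qed.

Lemma lincombK : cancel (lincomb e) (coords e).
Proof.
move=> a; apply/rowP => i; rewrite mxE /lincomb.
under eq_bigr do rewrite (tnth_nth 0).
by rewrite coord_sum_free ?(basis_free be).
Qed.

Lemma coords_tnth i : coords e (tnth e i) = delta_mx 0 i.
Proof.
apply/rowP => k; rewrite !mxE (tnth_nth 0) coord_free ?(basis_free be) //.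
by rewrite eqxx eq_sym.
Qed.

Lemma coords0 : coords e 0 = 0.
Proof. by apply/rowP => i; rewrite !mxE linear0. Qed.

Lemma lincomb_eq0 a : (lincomb e a == 0) = (a == 0).
Proof. by rewrite -(inj_eq (can_inj coordsK)) lincombK coords0. Qed.

Lemma coords_eq0 v : (coords e v == 0) = (v == 0).
Proof. by rewrite -{1}coords0 (inj_eq (can_inj coordsK)). Qed.

End Basis.

Definition biform V (b : V -> V -> R) :=
  (forall c u v w, b (c *: u + v) w = c * b u w + b v w) /\
  (forall c u v w, b w (c *: u + v) = c * b w u + b w v).

(** A property of plain functions, because conformal classes and
    pull-backs are made of plain functions; see [inner_product_dot]. *)
Definition inner_product V (b : V -> V -> R) :=
  [/\ biform b, forall u v, b u v = b v u & forall u, u != 0 -> 0 < b u u].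

Lemma dot_inner_product V (b : {dot V for idfun}) : inner_product b.
Proof.
split=> [|u v|u]; first split=> c u v w.
- by rewrite linearDl linearZl_LR.
- by rewrite linearDr linearZr_LR.
- by rewrite hermC expr0 mul1r.
- exact: neq0_dnorm_gt0.
Qed.

Lemma biformD V (b : V -> V -> R) : biform b ->
  (forall u v w, b (u + v) w = b u w + b v w) *
  (forall u v w, b w (u + v) = b w u + b w v) *
  (forall u, b 0 u = 0) * (forall u, b u 0 = 0) *
  (forall c u w, b (c *: u) w = c * b u w) *
  (forall c u w, b w (c *: u) = c * b w u).
Proof.
move=> [bl br].
have D1 u v w : b (u + v) w = b u w + b v w.
  by have := bl 1 u v w; rewrite scale1r mul1r.
have D2 u v w : b w (u + v) = b w u + b w v.
  by have := br 1 u v w; rewrite scale1r mul1r.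
have Z1 u : b 0 u = 0 by apply: (addrI (b 0 u)); rewrite -D1 !addr0.
have Z2 u : b u 0 = 0 by apply: (addrI (b u 0)); rewrite -D2 !addr0.
do ![split] => //.
- by move=> c u w; rewrite -[c *: u]addr0 bl Z1 addr0.
- by move=> c u w; rewrite -[c *: u]addr0 br Z2 addr0.
Qed.

Lemma inner_product_dot V (b : V -> V -> R) : inner_product b ->
  exists d : {dot V for idfun}, b = d.
Proof.
move=> [bb bs bp]; have bD := biformD bb.
have addl u' : zmod_morphism (b ^~ u').
  by move=> u v; rewrite bD -scaleN1r bD mulN1r.
have addr u : zmod_morphism (b u).
  by move=> v w; rewrite bD -scaleN1r bD mulN1r.
have scl u' : scalable_for *%R (b ^~ u') by move=> c u; rewrite bD.
have scr u : scalable_for (idfun \; *%R) (b u) by move=> c v; rewrite bD.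
pose i1 := isBilinear.Build R V V R *%R (idfun \; *%R) b addl addr scl scr.
have herm u v : b u v = (-1) ^+ false * idfun (b v u) by rewrite expr0 mul1r bs.
pose i2 := isHermitianSesquilinear.Build R V false idfun b herm.
pose i3 := isDotProduct.Build R V b bp.
pose d : {dot V for idfun} := HB.pack b i1 i2 i3.
by exists d.
Qed.

Lemma inner_product_pullback V W (L : 'Hom(V, W)) (b : W -> W -> R) :
  injective L -> inner_product b -> inner_product (fun u v => b (L u) (L v)).
Proof.
move=> injL [[bl br] bs bp]; split=> // [|u u0].
  by split=> c u v w; rewrite linearP /= ?bl ?br.
by rewrite bp // -(linear0 L) (inj_eq injL).
Qed.

Definition gram V n (e : n.-tuple V) (b : V -> V -> R) : 'M[R]_n :=
  \matrix_(i, j) b (tnth e i) (tnth e j).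

Lemma gramP V n (e : n.-tuple V) b u v : biform b ->
  b (lincomb e u) (lincomb e v) = (u *m gram e b *m v^T) 0 0.
Proof.
move=> bb; have bD := biformD bb.
have suml (I : Type) (r : seq I) (f : I -> V) w :
    b (\sum_(i <- r) f i) w = \sum_(i <- r) b (f i) w.
  by elim/big_rec2: _ => [|i x y _ <-]; rewrite bD.
have sumr (I : Type) (r : seq I) (f : I -> V) w :
    b w (\sum_(i <- r) f i) = \sum_(i <- r) b w (f i).
  by elim/big_rec2: _ => [|i x y _ <-]; rewrite bD.
rewrite /lincomb sumr mxE; apply: eq_bigr => j _.
rewrite bD suml !mxE mulrC; congr (_ * _); apply: eq_bigr => i _.
by rewrite bD mxE.
Qed.

Lemma qf_gram V n (e : n.-tuple V) b u : biform b ->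
  qf (gram e b) u = b (lincomb e u) (lincomb e u).
Proof. by move=> bb; rewrite gramP. Qed.

Lemma posdef_gram V n (e : n.-tuple V) b : basis_of fullv e ->
  inner_product b -> posdef (gram e b).
Proof.
move=> be [bb bs bp]; split.
  by apply/matrixP => i j; rewrite !mxE bs.
by move=> v v0; rewrite qf_gram // bp // (lincomb_eq0 be).
Qed.

Lemma gram_inj V n (e : n.-tuple V) b b' : basis_of fullv e ->
  biform b -> biform b' -> gram e b = gram e b' -> b = b'.
Proof.
move=> be bb bb' ebb'; apply/funext => u; apply/funext => v.
by rewrite -(coordsK be u) -(coordsK be v) !gramP // ebb'.
Qed.

(** The same [X] serves all forms: a change of basis acts on a whole family
    of Gram matrices by a single congruence. *)
Lemma gram_change V m n (e : m.-tuple V) (e' : n.-tuple V) :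
  basis_of fullv e ->
  exists X : 'M[R]_(n, m), forall b, biform b ->
    gram e' b = X *m gram e b *m X^T.
Proof.
move=> be; exists (\matrix_i coords e (tnth e' i)) => b bb.
apply/matrixP => i j; rewrite mxE.
rewrite -(coordsK be (tnth e' i)) -(coordsK be (tnth e' j)) gramP //.
set X := \matrix_k _.
have -> : coords e (tnth e' i) = row i X by rewrite rowK.
have -> : coords e (tnth e' j) = row j X by rewrite rowK.
rewrite tr_row -row_mul mxE [RHS]mxE; apply: eq_bigr => k _.
by congr (_ * _); rewrite mxE.
Qed.

Lemma size_basis_eq V m n (e : m.-tuple V) (e' : n.-tuple V) :
  basis_of fullv e -> basis_of fullv e' -> m = n.
Proof. by move=> /size_basis <- /size_basis. Qed.

Lemma gram_free V n (e : n.-tuple V) b : biform b -> posdef (gram e b) ->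
  free e.
Proof.
move=> bb [_ pe]; apply/freeP => k k0 i.
have v0 : lincomb e (\row_j k j) = 0.
  by rewrite -k0; apply: eq_bigr => j _; rewrite mxE (tnth_nth 0).
have [/rowP/(_ i)|/pe] := eqVneq (\row_j k j) 0; first by rewrite !mxE.
by rewrite qf_gram // v0 (biformD bb) ltxx.
Qed.

(** Positive definite matrices found by optimization are turned back into
    inner products in this way. *)
Lemma inner_product_of_gram V n (e : n.-tuple V) P : basis_of fullv e ->
  posdef P -> exists2 b, inner_product b & gram e b = P.
Proof.
move=> be [sP pP]; exists (fun u v => (coords e u *m P *m (coords e v)^T) 0 0).
  split=> [|u v|u u0]; last by apply: pP; rewrite (coords_eq0 be).
    split=> c u v w; first by rewrite coordsP !mulmxDl -!scalemxAl !mxE.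
    by rewrite coordsP [(_ + _)^T]linearP mulmxDr -scalemxAr !mxE.
  transitivity ((coords e u *m P *m (coords e v)^T)^T 0 0).
    by rewrite [RHS]mxE.
  by rewrite !trmx_mul trmxK sP mulmxA.
apply/matrixP => i j; rewrite mxE !(coords_tnth be).
by rewrite trmx_delta -colE -rowE !mxE.
Qed.

(** * The center of a family of inner products *)

(** Quantifying over all bases makes naturality immediate; by
    [center_formP] one basis is enough. *)
Definition center_form V (beta : int -> V -> V -> R) (b : V -> V -> R) :=
  inner_product b /\ forall n (e : n.-tuple V), basis_of fullv e ->
    is_center (fun k => gram e (beta k)) (gram e b).

Lemma center_formP V n (e : n.-tuple V) beta b : basis_of fullv e ->
  (forall k, inner_product (beta k)) -> inner_product b ->
  is_center (fun k => gram e (beta k)) (gram e b) -> center_form beta b.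
Proof.
move=> be ibeta ib cb; split=> // m e' be'.
have mn := size_basis_eq be be'; case: m / mn e' be' => e' be'.
have [X eX] := gram_change e' be.
have uX : X \in unitmx.
  have := posdef_unit (posdef_gram be' ib); rewrite eX; last by case: ib.
  by rewrite !unitmx_mul => /andP[/andP[]].
have -> : (fun k => gram e' (beta k)) = (fun k => X *m gram e (beta k) *m X^T).
  by apply/funext => k; apply: eX; case: (ibeta k).
by rewrite eX; [exact: is_center_congr | case: ib].
Qed.

Lemma center_form_exists V n (e : n.-tuple V) beta : basis_of fullv e ->
  (forall k, inner_product (beta k)) ->
  (exists s P, admissible (fun k => gram e (beta k)) s P) ->
  exists b, center_form beta b.
Proof.
move=> be ibeta adm.
have [|P [cP _]] := center_exists _ adm; first by move=> k; exact: posdef_gram.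
have [s [[pP _] _]] := cP; have [b ib bP] := inner_product_of_gram be pP.
by exists b; apply: (center_formP be) => //; rewrite bP.
Qed.

Lemma center_form_proportional V beta (b b' : V -> V -> R) :
  (forall k, inner_product (beta k)) ->
  center_form beta b -> center_form beta b' ->
  exists2 c, 0 < c & b' = fun u v => c * b u v.
Proof.
move=> ibeta [ib cb] [ib' cb']; pose e := vbasis {:V}.
have be : basis_of fullv e by exact: vbasisP.
have pC k : posdef (gram e (beta k)) by exact: posdef_gram.
have [c c0 cE] := is_center_proportional pC (cb _ e be) (cb' _ e be).
exists c => //; apply: (gram_inj be).
- by case: ib'.
- case: ib => -[bl br] _ _; split=> d u v w; rewrite ?bl ?br; ring.
- by rewrite cE; apply/matrixP => i j; rewrite !mxE.
Qed.

Lemma center_form_pullback V W (L : 'Hom(V, W)) beta b : bijective L ->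
  (forall k, inner_product (beta k)) ->
  center_form beta b ->
  center_form (fun k u v => beta k (L u) (L v)) (fun u v => b (L u) (L v)).
Proof.
move=> bijL ibeta [ib cb]; have injL := bij_inj bijL.
split=> [|n e be]; first exact: inner_product_pullback.
pose e' := map_tuple L e.
have gE b' : gram e (fun u v => b' (L u) (L v)) = gram e' b'.
  by apply/matrixP => i j; rewrite !mxE !tnth_map.
have be' : basis_of fullv e'.
  have -> : fullv = (L @: fullv)%VS.
    apply/eqP; rewrite eqEsubv subvf andbT; apply/subvP => w _.
    have [K LK KL] := bijL; rewrite -(KL w); exact: memv_img (memvf _).
  have /eqP kL : lker L == 0%VS by apply/lker0P.
  by apply: limg_basis_of be; rewrite kL capv0.
by rewrite gE; under [X in is_center X]eq_fun do rewrite gE; exact: cb.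
Qed.

Lemma center_form_shift V beta (b : V -> V -> R) : center_form beta b ->
  center_form (fun k => beta (k + 1)) b.
Proof.
move=> [ib cb]; split=> // n e be; exact: is_center_shift (cb n e be).
Qed.

End Forms.

(** * The operator of a conformal class and the distance to the metric *)

Section ConformalOperator.
Context {R : realType}.
Implicit Types V : vectType R.

Lemma gram_mx_in V n (e : n.-tuple V) b (A : 'End(V)) : basis_of fullv e ->
  biform b -> gram e (fun u v => b (A u) v) = mx_in e A *m gram e b.
Proof.
move=> be bb; apply/matrixP => i j; rewrite mxE.
rewrite -(coordsK be (A _)) -{1}(coordsK be (tnth e j)) gramP //.
rewrite (coords_tnth be) trmx_delta -colE mxE !mxE.
by apply: eq_bigr => k _; rewrite !mxE.
Qed.

Lemma biform_lfun V (b : V -> V -> R) (A : 'End(V)) : biform b ->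
  biform (fun u v => b (A u) v).
Proof. by move=> [bl br]; split=> c u v w; rewrite ?br // linearP bl. Qed.

(** For an inner product [b], the determinant of the Gram matrix of
    [b (A u) v] is the one of [A] times the one of [b]; both Gram determinants
    are multiplied by the same square when the basis changes. *)
Lemma lfun_detE V n (e : n.-tuple V) (A : 'End(V)) : basis_of fullv e ->
  lfun_det A = \det (mx_in e A).
Proof.
move=> be; rewrite /lfun_det; set e' := vbasis {:V}.
have be' : basis_of fullv e' by exact: vbasisP.
clearbody e'; have mn := size_basis_eq be' be.
move: e' be'; rewrite mn => e' be'.
have [b ib eb] := inner_product_of_gram be (posdef1 n); have [bb _ _] := ib.
have [X eX] := gram_change e' be.
have dE (e1 : n.-tuple V) : basis_of fullv e1 ->
    \det (gram e1 (fun u v => b (A u) v)) =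
    \det (mx_in e1 A) * \det (gram e1 b).
  by move=> be1; rewrite gram_mx_in // det_mulmx.
have := dE _ be'; rewrite !eX //; last exact: biform_lfun.
rewrite !det_congr dE // eb det1 !mulr1 mulrC.
have dX : \det X ^+ 2 != 0.
  have : posdef (gram e' b) by exact: posdef_gram.
  move=> /posdef_det_gt0; rewrite eX // det_congr eb det1 mulr1.
  by move=> /gt_eqF ->.
by move=> /(mulIf dX).
Qed.

Definition multiples V (b : V -> V -> R) : set (V -> V -> R) :=
  [set (fun u v => k * b u v) | k in [set k : R | 0 < k]].

Lemma multiples_conformal V (b : V -> V -> R) : inner_product b ->
  exists d : {dot V for idfun}, multiples b = multiples d.
Proof. by move=> /inner_product_dot [d ->]; exists d. Qed.

Definition conf_of V (b : V -> V -> R) (ib : inner_product b) : conformal V :=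
  Conformal (multiples_conformal ib).

Lemma conf_of_proportional V (b b' : V -> V -> R) k :
  0 < k -> b' = (fun u v => k * b u v) ->
  multiples b' = multiples b.
Proof.
move=> k0 ->; apply/seteqP; split=> _ [l /= l0 <-].
  exists (l * k); first exact: mulr_gt0.
  by apply/funext => u; apply/funext => v; rewrite mulrA.
exists (l / k); first exact: divr_gt0.
by apply/funext => u; apply/funext => v; rewrite mulrA divfK ?gt_eqF.
Qed.

(** In coordinates, the operator of a class is [a = k B G^-1], where [G] and
    [B] are the Gram matrices of [g] and [b] and [k > 0] makes [det a] equal to 1. *)
Lemma conf_op_mx V (g : {dot V for idfun}) (b : V -> V -> R)
    (ib : inner_product b) n (e : n.-tuple V) : basis_of fullv e ->
  let a := mx_in e (conf_op g (conf_of ib)) in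
  \det a = 1 /\ exists2 k, 0 < k & a *m gram e g = k *: gram e b.
Proof.
move=> be a; have ig := dot_inner_product g; have [bg _ _] := ig.
pose S := [set A : 'End(V) | lfun_det A = 1 /\
  conf_class (conf_of ib) (fun u v => g (A u) v)].
have [A SA] : S !=set0.
  pose e' := vbasis {:V}; have be' : basis_of fullv e' by exact: vbasisP.
  have pG := posdef_gram be' ig; have pB := posdef_gram be' ib.
  have [|k k0 dk] := posdef_scale_det pB (posdef_det_gt0 pG).
    by move: (gram _ _) => D dimV; move: D; rewrite dimV; exact: det_mx00.
  pose a' := k *: gram e' b *m invmx (gram e' g).
  exists (passmx.hommx e' e' a').
  have mxA : mx_in e' (passmx.hommx e' e' a') = a'.
    rewrite -[RHS](passmx.hommxK be' be'); apply/matrixP => i j.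
    by rewrite !mxE /= passmx.vecof_delta (tnth_nth 0).
  split.
    rewrite (lfun_detE _ be') mxA det_mulmx dk det_inv mulfV //.
    by rewrite gt_eqF // posdef_det_gt0.
  exists k => //=; apply: (gram_inj be').
  - by have [[bl br] _ _] := ib; split=> c u v w; rewrite ?bl ?br; ring.
  - exact: biform_lfun.
  - rewrite gram_mx_in // mxA mulmxKV ?posdef_unit //.
    by apply/matrixP => i j; rewrite !mxE.
have [dA [k /= k0 kb]] : S (conf_op g (conf_of ib)).
  exact: (xgetPex _ (ex_intro _ A SA)).
split; first by rewrite -lfun_detE.
exists k => //; rewrite -gram_mx_in //.
apply/matrixP => i j; rewrite !mxE.
by have := congr1 (fun h => h (tnth e i) (tnth e j)) kb.
Qed.

Lemma conf_op_self V (g : {dot V for idfun}) (ig : inner_product g)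
    n (e : n.-tuple V) : basis_of fullv e ->
  mx_in e (conf_op g (conf_of ig)) = 1%:M.
Proof.
move=> be; have [d1 [k k0 aG]] := conf_op_mx g ig be.
have uG := posdef_unit (posdef_gram be ig).
have ak : mx_in e (conf_op g (conf_of ig)) = k%:M.
  by rewrite -[LHS](mulmxK uG) aG -mul_scalar_mx mulmxK.
rewrite ak; move: d1; rewrite ak det_scalar => /eqP.
have [n0|n0] := posnP n; last by rewrite pexpr_eq1 ?ltW // => /eqP ->.
by move=> _; apply/matrixP => i; have := ltn_ord i; rewrite {2}n0.
Qed.

(** [posdef_congr1] applied to a Gram matrix is the Gram-Schmidt process. *)
Lemma orthonormal_basisP V (g : {dot V for idfun}) :
  basis_of fullv (orthonormal_basis g) /\
  gram (orthonormal_basis g) g = 1%:M.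
Proof.
have ig := dot_inner_product g; have [bg _ _] := ig.
pose S := [set e : (\dim {:V}).-tuple V | basis_of {:V} e /\
    forall i j, g (tnth e i) (tnth e j) = (i == j)%:R].
suff [e Se] : S !=set0.
  have [be ge] : S (orthonormal_basis g).
    exact: (xgetPex _ (ex_intro _ e Se)).
  by split=> //; apply/matrixP => i j; rewrite !mxE ge.
pose e' := vbasis {:V}; have be' : basis_of fullv e' by exact: vbasisP.
have [X uX XG] := posdef_congr1 (posdef_gram be' ig).
pose e := [tuple lincomb e' (row i X) | i < \dim {:V}].
have ge : gram e g = 1%:M.
  rewrite -XG; apply/matrixP => i j; rewrite mxE !tnth_mktuple gramP //.
  rewrite tr_row -row_mul mxE [RHS]mxE; apply: eq_bigr => k _.
  by congr (_ * _); rewrite mxE.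
exists e; split; last by move=> i j; have /matrixP/(_ i j) := ge; rewrite !mxE.
rewrite basisEfree subvf size_tuple leqnn !andbT.
by apply: (gram_free bg); rewrite ge; exact: posdef1.
Qed.

(** The distance formula in dimension at most [N], evaluated as if every
    eigenvalue had a logarithm of absolute value [N ln S]. *)
Definition dist_bound N (S : R) : R :=
  Num.sqrt N%:R / 2 * Num.sqrt (N%:R * (N%:R * ln S) ^+ 2).

(** The hypothesis bounds the eigenvalues from below by [S^-1]; as their
    product is 1, they are at most [S^(n-1)]. *)
Lemma spd_dist1_le n N (S : R) (C : 'M[R]_n) : (n <= N)%N -> 1 <= S ->
  posdef C -> \det C = 1 ->
  (forall v, qf 1%:M v ^+ n <= S * qf C v ^+ n) ->
  spd_dist1 C <= dist_bound N S.
Proof.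
move=> nN S1 pC dC qC.
have [l0 [l0C _]] := symmx_spectrum pC.1.
have lC : char_poly C = \prod_i ('X - (eigenvalues C 0 i)%:P).
  pose spectrum := [set l : 'rV[R]_n |
    char_poly C = \prod_i ('X - (l 0 i)%:P)].
  exact: (getPex (ex_intro spectrum l0 l0C)).
set l := eigenvalues C in lC.
have S0 : 0 < S by exact: lt_le_trans S1.
have lnS : 0 <= ln S by exact: ln_ge0.
have lgt0 := posdef_spectrum pC lC.
have lge i : S^-1 <= l 0 i.
  have [v v0 /qf_eigen vC] := char_poly_root_spectrum i lC.
  have := qC v; rewrite vC exprMn mulrA -[leLHS]mul1r ler_pM2r; last first.
    by rewrite exprn_gt0 ?qf1_gt0.
  move=> Sl; have [l1|l1] := ltP (l 0 i) 1; last first.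
    by apply: le_trans l1; rewrite invf_le1.
  rewrite -ler_pdivrMl // mulr1 in Sl; apply: le_trans Sl _.
  have n0 : (0 < n)%N by exact: leq_trans (ltn_ord i).
  by rewrite ler_iXnr // ltW.
have lle i : l 0 i <= S ^+ n.-1.
  have := det_spectrum lC; rewrite dC (bigD1 i) //= => /esym lprod.
  have p0 : 0 < \prod_(j < n | j != i) l 0 j by exact: prodr_gt0.
  have -> : l 0 i = (\prod_(j < n | j != i) l 0 j)^-1.
    by rewrite -[RHS]mul1r; apply: (canRL (mulfK _) lprod); rewrite gt_eqF.
  rewrite -[S ^+ _]invrK lef_pV2 ?posrE ?invr_gt0 ?exprn_gt0 // -exprVn.
  have -> : n.-1 = #|[pred j | j != i]| by rewrite cardC1 card_ord.
  rewrite -prodr_const; apply: ler_prod => j _.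
  by rewrite invr_ge0 ltW //= lge.
have lnl i : (ln (l 0 i)) ^+ 2 <= (N%:R * ln S) ^+ 2.
  have n0 : (0 < n)%N by exact: leq_trans (ltn_ord i).
  have N1 : 1 <= N%:R :> R by rewrite ler1n (leq_trans n0).
  have lnlow : - ln S <= ln (l 0 i).
    by rewrite -lnV ?posrE // ler_ln ?posrE ?invr_gt0.
  have lnup : ln (l 0 i) <= n.-1%:R * ln S.
    by rewrite mulr_natl -lnXn // ler_ln ?posrE ?exprn_gt0.
  have lnN : n.-1%:R * ln S <= N%:R * ln S.
    by rewrite ler_wpM2r // ler_nat (leq_trans (leq_pred _)).
  have lnN1 : ln S <= N%:R * ln S by rewrite ler_peMl.
  by rewrite -subr_ge0 subr_sqr; apply: mulr_ge0; lra.
rewrite /spd_dist1 /dist_bound; apply: ler_pM.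
- by rewrite mulr_ge0 ?sqrtr_ge0.
- exact: sqrtr_ge0.
- by rewrite ler_pM2r ?invr_gt0 // ler_wsqrtr // ler_nat.
- apply: ler_wsqrtr.
  apply: (@le_trans _ _ (\sum_(i < n) (N%:R * ln S) ^+ 2)).
    by apply: ler_sum => i _; exact: lnl.
  by rewrite sumr_const card_ord -[leLHS]mulr_natl ler_wpM2r ?sqr_ge0 ?ler_nat.
Qed.

(** If [X] sends [C] to the identity, the inequality between [C] and the
    identity becomes one between the identity and [X[Id]], the matrix whose
    eigenvalues enter the distance. *)
Lemma spd_dist_le n N (S : R) (C : 'M[R]_n) : (n <= N)%N -> 1 <= S ->
  posdef C -> \det C = 1 ->
  (forall v, qf C v ^+ n <= S * qf 1%:M v ^+ n) ->
  spd_dist C 1%:M <= dist_bound N S.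
Proof.
move=> nN S1 pC dC qC; rewrite /spd_dist.
set X := get _; have [uX XC] : X \in unitmx /\ gl_act X C = 1%:M.
  apply: (getPex (P := [set X : 'M[R]_n | X \in unitmx /\ gl_act X C = 1%:M])).
  (* [det C = 1] forces [det Y ^+ 2 = 1], so the normalizing factor is 1 *)
  have [Y uY YC] := posdef_congr1 pC; exists Y^T => /=.
  split; first by rewrite unitmx_tr.
  rewrite /gl_act trmxK YC det_mulmx det_tr -expr2.
  have := congr1 (fun A => \det A) YC; rewrite det_congr dC mulr1 det1 => ->.
  by rewrite powR1 scale1r.
pose k := \det (X^T *m X) `^ (- n%:R^-1).
have k0 : 0 < k.
  rewrite powR_gt0 // det_mulmx det_tr -expr2 exprn_even_gt0 //=.
  by rewrite -unitfE -unitmxE.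
have actE D : gl_act X D = k *: (X^T *m D *m X^T^T) by rewrite trmxK.
have uXT : X^T \in unitmx by rewrite unitmx_tr.
apply: spd_dist1_le => //.
- rewrite actE; apply: posdefZ => //; apply: posdef_congr => //.
  exact: posdef1.
- have := congr1 (fun A => \det A) XC.
  by rewrite !actE !detZ !det_congr dC !det1.
- move=> v; rewrite -{1}XC !actE !qfZ !qf_congr !exprMn mulrCA.
  by rewrite ler_pM2l ?exprn_gt0.
Qed.

End ConformalOperator.

(** * Borel sets *)

Lemma sigma_algebraD (T : Type) (G : set (set T)) (A B : set T) :
  <<s G >> A -> <<s G >> B -> <<s G >> (A `\` B).
Proof.
move=> GA GB; have [|+ _] := sigma_algebraP (U := setT) (C := <<s G >>) _.
  by move=> X _; exact: subsetT.
move=> /(_ (smallest_sigma_algebra _ _)) [_ cD _ cI].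
have -> : A `\` B = A `\` (A `&` B).
  apply/seteqP; split=> x [Ax nB]; split=> //; first by case.
  by move=> Bx; apply: nB.
by apply: cD; [exact: subIsetl | | exact: cI].
Qed.

(** The sets [B] with a Borel trace form a sigma-algebra, and the open rays
    generate the one of the reals. *)
Lemma borel_preimage (R : realType) (X : topologicalType) (U : set X)
    (h : X -> R) : open U ->
  (forall c, <<s @open X >> (U `&` [set x | h x <= c])) ->
  forall B, measurable B -> <<s @open X >> (U `&` h @^-1` B).
Proof.
move=> oU hc B mB; have mU : <<s @open X >> U by exact: sub_sigma_algebra.
have {mB} : <<s @ocitv R >> B by exact: mB.
have -> : <<s @ocitv R >> = <<s @RGenOInfty.G R >>.
  exact: (RGenOInfty.measurableE R).
move: B; apply: (smallest_sub (X := image_set_system U h <<s @open X >>)).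
  apply: sigma_algebra_image.
  split; [exact: sigma_algebra0 | by move=> A; exact: sigma_algebraD |].
  exact: sigma_algebra_bigcup.
move=> _ [c ->] /=.
rewrite /image_set_system /= (_ : _ `&` _ = U `\` (U `&` [set x | h x <= c])).
  exact: sigma_algebraD.
apply/seteqP; split=> x /=; rewrite in_itv /= andbT ltNge.
  by move=> [Ux /negP hx]; split=> // -[].
by move=> [Ux nhx]; split=> //; apply/negP => hx; apply: nhx.
Qed.

Lemma sigma_algebra_bigcup_countable (J : countType) (T : Type)
    (G : set (set T)) (A : J -> set T) :
  (forall i, <<s G >> (A i)) -> <<s G >> (\bigcup_i A i).
Proof.
move=> GA; pose B n := if unpickle n is Some i then A i else set0.
rewrite (_ : \bigcup_i A i = \bigcup_n B n).
  apply: sigma_algebra_bigcup => n; rewrite /B.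
  by case: unpickle => [i|]; [exact: GA | exact: sigma_algebra0].
apply/seteqP; split=> x [].
  by move=> i _ Ai; exists (pickle i); [exact: I | rewrite /B pickleK].
by move=> n _; rewrite /B; case: unpickle => // i Ai; exists i.
Qed.

(** * Vector bundles with a metric *)

Section Bundle.
Context {R : realType} {M : topologicalType} {E : vector_bundle R M}.
Variable g : bundle_metric E.

Lemma proj_incl x (v : fiber E x) : bundle_proj E (fiber_incl E x v) = x.
Proof. by have [fE _ _] := incl_bij E x; exact: (fE v). Qed.

Lemma incl_inj x : injective (fiber_incl E x).
Proof.
have [_ iE _] := incl_bij E x; move=> u v uv.
by apply: (iE u v); rewrite ?in_setT.
Qed.

Lemma incl_surj (p : total_space E) :
  exists v : fiber E (bundle_proj E p), fiber_incl E _ v = p.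
Proof.
have [_ _ /(_ p erefl) [v _ vp]] := incl_bij E (bundle_proj E p).
by exists v.
Qed.

(** The metric as a function on the total space: iterates of the cocycle can
    then be measured without naming the fibre in which they land. *)
Definition sqnorm (p : total_space E) : R :=
  xget 0 [set r | exists x (v : fiber E x),
    p = fiber_incl E x v /\ r = g x v v].

Lemma sqnorm_incl x (v : fiber E x) : sqnorm (fiber_incl E x v) = g x v v.
Proof.
rewrite /sqnorm; case: xgetP => [r -> [y [w [vw ->]]]|/(_ (g x v v)) []].
  have xy : x = y by rewrite -(proj_incl v) vw proj_incl.
  by case: y / xy w vw => w /incl_inj ->.
by exists x, v.
Qed.

Lemma open_cvg (T U : topologicalType) (A : set T) (h : T -> U) x :
  open A -> A x -> {within A, continuous h} -> h @ x --> h x.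
Proof.
move=> oA Ax; rewrite continuous_open_subspace // => /(_ x).
by apply; rewrite inE.
Qed.

Lemma gram_metric_cvg (t : trivialization E) x : triv_dom t x ->
  gram (triv_frame t y) (g y) @[y --> x] --> gram (triv_frame t x) (g x).
Proof.
move=> tx; apply: (mx_cvg (F := nbhs x)) => i j; rewrite mxE.
under eq_fun do rewrite mxE.
have oU := @triv_dom_open _ _ _ t.
exact: (open_cvg oU tx (@metric_continuous _ _ _ g t i j)).
Qed.

(** Near a point it is the quadratic form of the Gram matrix of a local frame,
    evaluated at the coordinates. *)
Lemma sqnorm_continuous : continuous sqnorm.
Proof.
move=> p; have [t tp] := bundle_trivial E (bundle_proj E p).
pose G y := gram (triv_frame t y) (g y).
have sqnormE q : triv_dom t (bundle_proj E q) ->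
    sqnorm q = qf (G (bundle_proj E q)) (triv_coord t q).
  move=> tq; have [v vq] := incl_surj q; set y := bundle_proj E q in tq v vq *.
  have ig := dot_inner_product (g y); have [bg _ _] := ig.
  have -> : triv_coord t q = coords (triv_frame t y) v.
    by rewrite -vq triv_coordE.
  by rewrite qf_gram // coordsK ?triv_basis // -vq sqnorm_incl.
pose V := bundle_proj E @^-1` triv_dom t.
have oV : open V.
  apply: open_comp; last exact: triv_dom_open.
  by move=> q _; exact: Defs.proj_continuous.
have nearV : \forall q \near p, V q by apply: open_nbhs_nbhs.
rewrite /continuous_at (sqnormE p tp).
apply: cvg_trans.
  apply: (near_eq_cvg (f := fun q =>
    qf (G (bundle_proj E q)) (triv_coord t q))).
  by apply: filterS nearV => q Vq; rewrite sqnormE.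
have cG : G (bundle_proj E q) @[q --> p] --> G (bundle_proj E p).
  apply: (cvg_comp (bundle_proj E) G); first exact: Defs.proj_continuous.
  exact: gram_metric_cvg.
have cc : triv_coord t q @[q --> p] --> triv_coord t p.
  exact: (open_cvg oV tp (@triv_coord_continuous _ _ _ t)).
apply: (cvg_coord (f := fun q =>
  triv_coord t q *m G (bundle_proj E q) *m (triv_coord t q)^T)).
apply: cvg_mulmx; first exact: cvg_mulmx.
apply: mx_cvg => i j; rewrite mxE; under eq_fun do rewrite mxE.
exact: cvg_coord.
Qed.

(** Stated for maps of the total space, which can be iterated in [Z]; the
    linear maps themselves have types that vary along the orbit. *)
Definition fiberwise_iso (H : total_space E -> total_space E) (h : M -> M) :=
  forall x, exists2 L : 'Hom(fiber E x, fiber E (h x)), bijective L &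
    forall v, H (fiber_incl E x v) = fiber_incl E (h x) (L v).

Lemma fiberwise_iso_iter H h m : fiberwise_iso H h ->
  fiberwise_iso (iter m H) (iter m h).
Proof.
move=> isoH; elim: m => [|m IH] x.
  exists \1%VF; last by move=> v; rewrite id_lfunE.
  by exists id => v; rewrite id_lfunE.
have [L bL HL] := IH x; have [L' bL' HL'] := isoH (iter m h x).
exists (L' \o L)%VF; last by move=> v; rewrite /= HL HL' comp_lfunE.
apply: (eq_bij (bij_comp bL' bL)) => v; by rewrite comp_lfunE.
Qed.

(** The equality [h (h' x) = x] of base points is used to rewrite the type
    of the linear map over [h' x] before it is inverted. *)
Lemma fiberwise_iso_inv H h H' h' : fiberwise_iso H h ->
  cancel H H' -> cancel h' h -> fiberwise_iso H' h'.
Proof.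
move=> isoH HK hK x; have [L bL HL] := isoH (h' x).
move: L bL HL; rewrite hK => L bL HL.
have kL : lker L == 0%VS by apply/lker0P; exact: bij_inj bL.
have [K LK KL] := bL.
have LV : cancel (L^-1)%VF L.
  by move=> w; rewrite -(KL w) lker0_lfunK.
exists (L^-1)%VF; first by exists L => //; exact: lker0_lfunK.
by move=> w; rewrite -{1}(LV w) -HL HK.
Qed.

(** The supremum defining the norm is a genuine one: it is taken over a nonempty
    set, bounded by [posdef_dominates]. *)
Lemma fiber_opnormP H x y (L : 'Hom(fiber E x, fiber E y)) :
  (forall v, H (fiber_incl E x v) = fiber_incl E y (L v)) ->
  0 <= fiber_opnorm g H x y /\
  forall u, g y (L u) (L u) <= fiber_opnorm g H x y ^+ 2 * g x u u.
Proof.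
move=> HL; rewrite /fiber_opnorm; set S := [set r | _].
have igx := dot_inner_product (g x); have [bgx _ px] := igx.
have igy := dot_inner_product (g y); have [bgy _ py] := igy.
have gy0 w : 0 <= g y w w.
  by have [->|/py/ltW//] := eqVneq w 0; rewrite (biformD bgy).
have bL : biform (fun u v => g y (L u) (L v)).
  by case: bgy => bl br; split=> c u v w; rewrite linearP ?bl ?br.
pose e := vbasis {:fiber E x}; have be : basis_of fullv e by exact: vbasisP.
have [c c0 cS] := posdef_dominates (gram e (fun u v => g y (L u) (L v)))
  (posdef_gram be igx).
have gc u : g y (L u) (L u) <= c * g x u u.
  by have := cS (coords e u); rewrite !qf_gram // coordsK.
have S_ub : has_ubound S.
  exists (Num.sqrt c) => _ [u [w [u1 /[!HL] /incl_inj <- ->]]].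
  by rewrite ler_wsqrtr // (le_trans (gc u)) // ler_piMr.
have S0 : S 0.
  exists 0, 0; split; first by rewrite (biformD bgx) ler01.
    by rewrite HL linear0.
  by rewrite (biformD bgy) sqrtr0.
have op0 : 0 <= sup S by exact: ub_le_sup.
split=> // u; have [->|u0] := eqVneq u 0.
  by rewrite linear0 (biformD bgx) (biformD bgy) mulr0.
have gu := px u u0; pose a := Num.sqrt (g x u u).
have a0 : 0 < a by rewrite sqrtr_gt0.
have aa : a ^+ 2 = g x u u by rewrite sqr_sqrtr // ltW.
have Su : S (Num.sqrt (g y (L (a^-1 *: u)) (L (a^-1 *: u)))).
  exists (a^-1 *: u), (L (a^-1 *: u)); split=> //.
  by rewrite !(biformD bgx) -aa expr2 mulKf ?gt_eqF // mulVf ?gt_eqF.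
have := ub_le_sup S_ub Su; rewrite linearZ !(biformD bgy) mulrA -expr2 => le_op.
rewrite -aa -exprMn -[leLHS]sqr_sqrtr // lerXn2r ?nnegrE ?sqrtr_ge0 //.
  by rewrite mulr_ge0 // ltW.
move: le_op; rewrite sqrtrM ?sqr_ge0 // sqrtr_sqr.
rewrite ger0_norm ?invr_ge0 ?(ltW a0) //.
by rewrite ler_pdivrMl // mulrC.
Qed.

(** The operator of the class of [g] is the identity in every frame. *)
Lemma metric_structure_continuous :
  continuous_structure g (fun x => conf_of (dot_inner_product (g x))).
Proof.
move=> t i j; have oU := @triv_dom_open _ _ _ t.
rewrite continuous_open_subspace // => x; rewrite inE => tx.
have mx1 y : triv_dom t y -> mx_in (triv_frame t y)
    (conf_op (g y) (conf_of (dot_inner_product (g y)))) i j =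
    (1%:M : 'M[R]__) i j.
  by move=> ty; rewrite conf_op_self //; exact: triv_basis.
rewrite /continuous_at mx1 //; apply: cvg_near_cst.
have : \forall z \near x, triv_dom t z by apply: open_nbhs_nbhs.
by apply: filterS => z /mx1 ->.
Qed.

(** The rank is locally constant. *)
Lemma bounded_rank : compact [set: M] ->
  exists N, forall x, (\dim {:fiber E x} <= N)%N.
Proof.
move=> /compact_near_coveringP cM.
have : \forall N \near \oo, [set: M] `<=` (fun x => (\dim {:fiber E x} <= N)%N).
  apply: cM => x _; have [t tx] := bundle_trivial E x.
  exists (triv_dom t, [set N | (triv_rank t <= N)%N]); last first.
    by move=> [y N] /= [ty rN]; rewrite (size_basis (triv_basis ty)).
  split; last exact: nbhs_infty_ge.
  by apply: open_nbhs_nbhs; split=> //; exact: triv_dom_open.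
by move=> /filter_ex [N leN]; exists N => x; exact: leN.
Qed.

End Bundle.

(** * The invariant conformal structure of a quasiconformal cocycle *)

Lemma iterzS (T : Type) (h hinv : T -> T) k p : cancel h hinv ->
  iterz h hinv (k + 1) p = iterz h hinv k (h p).
Proof.
move=> hK; case: k => [m|[|m]].
- have -> : Posz m + 1 = Posz m.+1 by rewrite -PoszD addn1.
  by rewrite /iterz iterSr.
- exact: esym (hK p).
- have -> : Negz m.+1 + 1 = Negz m.
    by rewrite !NegzE -[m.+2]addn1 PoszD opprD addrNK.
  by rewrite /iterz [RHS]iterSr hK.
Qed.

Lemma iterz_continuous (T : topologicalType) (h hinv : T -> T) k :
  continuous h -> continuous hinv -> continuous (iterz h hinv k).
Proof.
have it h' m : continuous h' -> continuous (iter m h' : T -> T).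
  move=> ch; elim: m => [|m IH] x; first exact: cvg_id.
  exact: (continuous_comp (IH x) (ch _)).
by move=> ch chinv; case: k => m; exact: it.
Qed.

Section Dynamics.
Context {R : realType} {n : nat} {M : manifold R n} (f : diffeo M).
Context {E : vector_bundle R M} (g : bundle_metric E) (F : linear_cocycle E f).

Let Fz k := iterz (cocycle_map F) (cocycle_inv F) k.
Let fz k := iterz f (diffeo_inv f) k.

Lemma iterate_fiberwise_iso k : fiberwise_iso (Fz k) (fz k).
Proof.
have isoF : fiberwise_iso (cocycle_map F) f.
  move=> x; exists (F x); first exact: cocycle_fiber_bij.
  exact: cocycle_mapE.
case: k => m; apply: fiberwise_iso_iter => //.
apply: fiberwise_iso_inv isoF _ _; [exact: cocycle_mapK | exact: diffeo_invK].
Qed.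

(** The pull-back of the metric by the iterate of index [k], recovered by
    polarization from [sqnorm], so that it is visibly continuous in [x]. *)
Definition pulled_metric k x (u v : fiber E x) : R :=
  (sqnorm g (Fz k (fiber_incl E x (u + v))) - sqnorm g (Fz k (fiber_incl E x u))
   - sqnorm g (Fz k (fiber_incl E x v))) / 2.

Lemma pulled_metricE k x (L : 'Hom(fiber E x, fiber E (fz k x))) :
  (forall v, Fz k (fiber_incl E x v) = fiber_incl E (fz k x) (L v)) ->
  pulled_metric k (x := x) = fun u v => g (fz k x) (L u) (L v).
Proof.
move=> LE; apply/funext => u; apply/funext => v.
rewrite /pulled_metric !LE !sqnorm_incl linearD /=.
have [bg sg _] := dot_inner_product (g (fz k x)).
by rewrite !(biformD bg) (sg (L v) (L u)); field.
Qed.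

Lemma pulled_metric_inner k x : inner_product (pulled_metric k (x := x)).
Proof.
have [L bL LE] := iterate_fiberwise_iso k x; rewrite (pulled_metricE LE).
apply: inner_product_pullback; first exact: bij_inj bL.
exact: dot_inner_product.
Qed.

Lemma pulled_metric0 x : pulled_metric 0 (x := x) = g x.
Proof.
rewrite (@pulled_metricE 0 x \1%VF) => [|v]; last by rewrite id_lfunE.
by apply/funext => u; apply/funext => v; rewrite !id_lfunE.
Qed.

(** The cocycle shifts the family of pull-backs: this is the source of
    invariance. *)
Lemma pulled_metricS k x u v :
  pulled_metric k (F x u) (F x v) = pulled_metric (k + 1) u v.
Proof.
rewrite /pulled_metric -linearD /= -!cocycle_mapE /Fz.
by rewrite !(iterzS _ _ (@cocycle_mapK _ _ _ _ F)).
Qed.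

(** A vector with constant coordinates in a frame moves continuously in the
    total space; so do its images by the iterates, and their norms. *)
Lemma gram_pulled_metric_cvg (t : trivialization E) k x : triv_dom t x ->
  gram (triv_frame t y) (pulled_metric k (x := y)) @[y --> x] -->
  gram (triv_frame t x) (pulled_metric k (x := x)).
Proof.
move=> tx; pose e y := triv_frame t y.
have cvg_sq a :
    sqnorm g (Fz k (fiber_incl E y (lincomb (e y) a))) @[y --> x] -->
    sqnorm g (Fz k (fiber_incl E x (lincomb (e x) a))).
  pose S (p : M * 'rV[R]_(triv_rank t)) :=
    fiber_incl E p.1 (\sum_i p.2 0 i *: tnth (triv_frame t p.1) i).
  have cS : S @ (x, a) --> S (x, a).
    apply: (open_cvg (A := triv_dom t `*` setT)) => //.
      rewrite (_ : _ `*` _ = fst @^-1` triv_dom t); last first.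
        by apply/seteqP; split=> p; [case | split].
      by apply: open_comp (@triv_dom_open _ _ _ t) => p _; exact: cvg_fst.
    exact: triv_continuous.
  have cy : (y, a) @[y --> x] --> (x, a).
    apply: (@cvg_pair _ _ _ (nbhs x) (nbhs x) (nbhs a) _ _ _ id (fun=> a));
      first exact: cvg_id.
    exact: cvg_cst.
  have cSy := cvg_comp _ _ cy cS.
  have cF : continuous (Fz k).
    apply: iterz_continuous; first exact: cocycle_continuous.
    exact: cocycle_inv_continuous.
  have cFS := cvg_comp _ _ cSy (cF (S (x, a))).
  exact: (cvg_comp _ _ cFS (@sqnorm_continuous _ _ _ g _)).
have tnthE y i : tnth (e y) i = lincomb (e y) (delta_mx 0 i).
  rewrite /lincomb (bigD1 i) //= mxE !eqxx scale1r big1 ?addr0 // => j ji.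
  by rewrite mxE (negPf ji) andbF scale0r.
have addE y i j : tnth (e y) i + tnth (e y) j =
    lincomb (e y) (delta_mx 0 i + delta_mx 0 j).
  by rewrite !tnthE -[in RHS](scale1r (delta_mx 0 i)) lincombP scale1r.
apply: (mx_cvg (F := nbhs x)) => i j; rewrite mxE; under eq_fun do rewrite mxE.
apply: cvgM; last exact: cvg_cst.
rewrite addE !tnthE; under eq_fun do rewrite addE !tnthE.
by apply: cvgB; [apply: cvgB|]; exact: cvg_sq.
Qed.

(** Let [a] and [b] be the norms of the iterate of index [k] and of its
    inverse. Then [g <= b^2 C_k], and [det C_k <= a^(2d) det g] by
    [posdef_det_le]; only [(a b)^(2d)] enters the product of the estimates. *)
Lemma metric_admissible K x d (e : d.-tuple (fiber E x)) : basis_of fullv e ->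
  (forall k, quasiconformal_distortion g F x k <= K) -> 0 <= K ->
  admissible (fun k => gram e (pulled_metric k (x := x)))
    (K ^+ (2 * d)) (gram e (g x)).
Proof.
move=> be qc K0; have ig := dot_inner_product (g x); have [bg _ _] := ig.
have pG := posdef_gram be ig; split=> // k v.
have [L bL LE] := iterate_fiberwise_iso k x.
have [K' LK KL] := bL.
have kL : lker L == 0%VS by apply/lker0P; exact: bij_inj bL.
have LV : cancel (L^-1)%VF L by move=> w; rewrite -(KL w) lker0_lfunK.
have FzK p : iterz (cocycle_inv F) (cocycle_map F) k (Fz k p) = p.
  have FK := @cocycle_mapK _ _ _ _ F; have KF := @cocycle_invK _ _ _ _ F.
  have iterK (h h' : total_space E -> total_space E) m :
      cancel h h' -> iter m h' (iter m h p) = p.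
    by move=> hK; elim: m => // m IH; rewrite [LHS]iterSr iterS hK.
  by rewrite /Fz; clear -iterK FK KF; case: k => m; exact: iterK.
have [a0 La] := fiber_opnormP g LE; set a := fiber_opnorm _ _ _ _ in a0 La.
have LVE w : iterz (cocycle_inv F) (cocycle_map F) k (fiber_incl E (fz k x) w) =
    fiber_incl E x ((L^-1)%VF w).
  by rewrite -{1}(LV w) -LE FzK.
have [b0 Lb] := fiber_opnormP g LVE; set b := fiber_opnorm _ _ _ _ in b0 Lb.
have ab : a * b <= K by exact: qc.
set C := gram e (pulled_metric k (x := x)).
have pC : posdef C := posdef_gram be (pulled_metric_inner k x).
have bC : biform (pulled_metric k (x := x)) by case: (pulled_metric_inner k x).
have Gv : qf (gram e (g x)) v <= b ^+ 2 * qf C v.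
  rewrite !qf_gram // (pulled_metricE LE).
  by have := Lb (L (lincomb e v)); rewrite lker0_lfunK.
have dC : \det C <= (a ^+ 2) ^+ d * \det (gram e (g x)).
  apply: posdef_det_le => // w; rewrite !qf_gram // (pulled_metricE LE).
  exact: La.
have G0 := posdef_ge0 v pG; have C0 := posdef_ge0 v pC.
apply: (@le_trans _ _ ((b ^+ 2 * qf C v) ^+ d *
    ((a ^+ 2) ^+ d * \det (gram e (g x))))).
  apply: ler_pM => //; rewrite ?exprn_ge0 //.
    exact: ltW (posdef_det_gt0 pC).
  by apply: lerXn2r; rewrite ?nnegrE // mulr_ge0 ?sqr_ge0.
have -> : (b ^+ 2 * qf C v) ^+ d *
    ((a ^+ 2) ^+ d * \det (gram e (g x))) = (a * b) ^+ (2 * d) *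
    \det (gram e (g x)) * qf C v ^+ d.
  by rewrite exprM !exprMn; ring.
rewrite ler_wpM2r ?exprn_ge0 // ler_wpM2r ?(ltW (posdef_det_gt0 pG)) //.
by apply: lerXn2r; rewrite ?nnegrE ?mulr_ge0.
Qed.

Section CenterStructure.
Variable b : forall x, fiber E x -> fiber E x -> R.
Hypothesis ib : forall x, inner_product (@b x).
Hypothesis cb : forall x,
  center_form (fun k => pulled_metric k (x := x)) (@b x).

Let C (t : trivialization E) y k :=
  gram (triv_frame t y) (pulled_metric k (x := y)).

Lemma posdef_pulled_gram t y k : triv_dom t y -> posdef (C t y k).
Proof.
move=> ty; exact: posdef_gram (triv_basis ty) (pulled_metric_inner k y).
Qed.

(** The matrix of the operator, multiplied by the Gram matrix of the
    metric, is the center normalized by the determinant of the metric. *)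
Lemma conf_op_center t y : triv_dom t y ->
  let a := mx_in (triv_frame t y) (conf_op (g y) (conf_of (ib y))) in
  \det a = 1 /\ is_center (C t y) (a *m C t y 0).
Proof.
move=> ty a; have [da [k k0 aG]] := conf_op_mx (g y) (ib y) (triv_basis ty).
split=> //; rewrite /C pulled_metric0 aG; apply: is_centerZ => //.
by apply: (cb y).2; exact: triv_basis.
Qed.

(** [feasible_closed] along the neighbourhoods of a point of the domain. *)
Lemma infeasible_open t Z s : closed Z ->
  open (triv_dom t `&` [set y | ~ exists P, feasible Z (C t y) s P]).
Proof.
move=> clZ; have oU := @triv_dom_open _ _ _ t.
rewrite openE => y [ty noP].
have nearU : \forall z \near y, triv_dom t z by apply: open_nbhs_nbhs.
have nearnoP : \forall z \near y, ~ exists P, feasible Z (C t z) s P.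
  apply: (@feasible_closed _ _ _ (nbhs y) _ (C t) (fun=> s) (C t y) s) => //.
  - by apply: filterS nearU => z tz k; exact: posdef_pulled_gram.
  - by move=> k; exact: posdef_pulled_gram.
  - by move=> k; exact: gram_pulled_metric_cvg.
  - exact: cvg_cst.
by rewrite /interior /=; apply: filterI.
Qed.

(** By [center_mem_closed], the entry [(i, j)] is at most [c] unless some
    rational level is attained, but not under the constraint that the entry be
    at most [c]. With [P = a *m C 0], this constraint becomes polynomial in [P]
    and [C 0] when the inverse of [C 0] is replaced by its adjugate. *)
Lemma center_structure_measurable :
  measurable_structure g (fun x => conf_of (ib x)).
Proof.
move=> t i j B mB; have oU := @triv_dom_open _ _ _ t.
apply: borel_preimage mB => // c.
pose h y := mx_in (triv_frame t y) (conf_op (g y) (conf_of (ib y))) i j.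
change (<<s @open M >> (triv_dom t `&` [set y | h y <= c])).
pose Z := [set p : 'M[R]_(triv_rank t) * 'M[R]_(triv_rank t) |
  (p.1 *m \adj p.2) i j - c * \det p.2 <= 0].
have clZ : closed Z.
  apply: (@closed_comp _ _ (fun p : 'M[R]_(triv_rank t) * 'M[R]_(triv_rank t) =>
    (p.1 *m \adj p.2) i j - c * \det p.2) [set r | r <= 0]).
    move=> p _.
    have c1 : fst @ p --> p.1 by exact: cvg_fst.
    have c2 : snd @ p --> p.2 by exact: cvg_snd.
    apply: cvgB; last by apply: cvgM; [exact: cvg_cst | exact: cvg_det].
    apply: (cvg_coord (f := fun p => p.1 *m \adj p.2)).
    by apply: cvg_mulmx => //; exact: cvg_adj.
  exact: closed_le.
pose W Z' (q : rat) := triv_dom t `&`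
  [set y | ~ exists P, feasible Z' (C t y) (ratr q) P].
have mW Z' q : closed Z' -> <<s @open M >> (W Z' q).
  by move=> clZ'; apply: sub_sigma_algebra; exact: infeasible_open.
rewrite (_ : _ `&` _ = triv_dom t `\` \bigcup_q (W Z q `\` W setT q)).
  apply: sigma_algebraD; first exact: sub_sigma_algebra.
  apply: sigma_algebra_bigcup_countable => q; apply: sigma_algebraD; exact: mW.
suff hZ y : triv_dom t y -> h y <= c <-> forall q : rat,
    (exists P, feasible setT (C t y) (ratr q) P) ->
    exists P, feasible Z (C t y) (ratr q) P.
  apply/seteqP; split=> y /= [ty hy]; split=> //.
    move=> [q _ [[_ nZ] nT]]; apply: nT; split=> // fT; apply: nZ.
    exact: (hZ y ty).1.
  apply/(hZ y ty) => q fT; apply: contrapT => nZ.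
  by apply: hy; exists q => //; split=> // -[_].
move=> ty; have [da cP] := conf_op_center ty.
set a := mx_in _ _ in da cP.
have pC k : posdef (C t y k) by exact: posdef_pulled_gram.
rewrite -(center_mem_closed pC clZ cP); last by rewrite det_mulmx da mul1r.
rewrite /Z /= -mulmxA mul_mx_adj mul_mx_scalar mxE -/(h y).
have -> : h y = a i j by [].
by rewrite mulrC -mulrBl pmulr_lle0 ?posdef_det_gt0 // subr_le0.
Qed.

(** The pull-back by [F x] of the center at [f x] is a center of the shifted
    family at [x], to which the center at [x] also belongs as a center. *)
Lemma center_structure_preserved :
  preserves_structure F (fun x => conf_of (ib x)).
Proof.
move=> x; rewrite /pullback /=.
pose b' u v := b (F x u) (F x v).
have cb' : center_form (fun k => pulled_metric (k + 1) (x := x)) b'.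
  have := center_form_pullback (cocycle_fiber_bij F x)
    (fun k => pulled_metric_inner k (f x)) (cb (f x)).
  congr center_form; apply/funext => k; apply/funext => u; apply/funext => v.
  exact: pulled_metricS.
have [c c0 b'E] := center_form_proportional
  (fun k => pulled_metric_inner (k + 1) x) (center_form_shift (cb x)) cb'.
rewrite -(conf_of_proportional c0 b'E).
apply/seteqP; split=> [_ [_ [k k0 <-] <-]|_ [k k0 <-]]; first by exists k.
by exists (fun u v => k * b u v) => //; exists k.
Qed.

(** The metric is admissible at level [K^(2d)], so the center is too; its
    constraint of index 0 compares it with the metric. *)
Lemma center_structure_dist_le x N K : (\dim {:fiber E x} <= N)%N -> 1 <= K ->
  (forall k, quasiconformal_distortion g F x k <= K) ->
  conf_dist (g x) (conf_of (ib x)) (conf_of (dot_inner_product (g x))) <=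
  dist_bound N (K ^+ (2 * N)).
Proof.
move=> dN K1 qc; have [be ge] := orthonormal_basisP (g x).
rewrite /conf_dist conf_op_self //; set e := orthonormal_basis (g x) in be ge *.
have [da [k k0 aG]] := conf_op_mx (g x) (ib x) be; rewrite ge mulmx1 in aG.
set a := mx_in e _ in da aG *.
have pa : posdef a by rewrite aG; apply: posdefZ => //; exact: posdef_gram.
have ca : is_center (fun k => gram e (pulled_metric k (x := x))) a.
  by rewrite aG; apply: is_centerZ => //; exact: (cb x).2.
apply: spd_dist_le => //; first exact: exprn_ege1.
have [s [[_ sa] smin]] := ca.
have /smin sK := metric_admissible be qc (le_trans ler01 K1).
move=> v; have := sa 0 v; rewrite pulled_metric0 ge da det1 !mulr1 => le_s.
apply: (le_trans le_s); rewrite ler_wpM2r ?exprn_ge0 //.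
  by apply: posdef_ge0; exact: posdef1.
apply: (le_trans sK); rewrite ler_weXn2l // leq_mul2l.
exact: dN.
Qed.

End CenterStructure.

Lemma center_form_pulled_exists x K : 1 <= K ->
  (forall k, quasiconformal_distortion g F x k <= K) ->
  exists b, center_form (fun k => pulled_metric k (x := x)) b.
Proof.
move=> K1 qc; have be : basis_of fullv (vbasis {:fiber E x}) by exact: vbasisP.
apply: (center_form_exists be) => [k|]; first exact: pulled_metric_inner.
by do 2!eexists; exact: metric_admissible be qc (le_trans ler01 K1).
Qed.

End Dynamics.

Theorem proposition2p4 (R : realType) (n : nat) (M : manifold R n)
    (M_compact : compact [set: M]) (f : diffeo M) (E : vector_bundle R M)
    (g : bundle_metric E) (F : linear_cocycle E f) :
  uniformly_quasiconformal g F ->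
  exists tau : conformal_structure E,
    [/\ measurable_structure g tau, bounded_structure g tau &
        preserves_structure F tau].
Proof.
move=> [K0 qc0]; pose K := Num.max 1 K0.
have K1 : 1 <= K by rewrite le_max lexx.
have qc x k : quasiconformal_distortion g F x k <= K.
  by apply: (le_trans (qc0 x k)); rewrite le_max lexx orbT.
have [N leN] := bounded_rank (E := E) M_compact.
pose b x := sval (cid (center_form_pulled_exists K1 (qc x))).
have cb x : center_form (fun k => pulled_metric g F k (x := x)) (b x).
  exact: svalP (cid (center_form_pulled_exists K1 (qc x))).
exists (fun x => conf_of (cb x).1); split.
- exact: center_structure_measurable.
- exists (fun x => conf_of (dot_inner_product (g x))).
    exact: metric_structure_continuous.
  exists (dist_bound N (K ^+ (2 * N))) => x.
  exact: (center_structure_dist_le (fun y => (cb y).1) cb).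
- exact: center_structure_preserved.
Qed.
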